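(* Let $x : M \rightarrow \mathbb{E}^{4}$ be a connected surface in $\mathbb{E}^4$ (isometrically immersed) with constant mean curvature. Then $M$ has homothetic Laplace transformation if and only if $M$ is a minimal surface in a hypersphere of $\mathbb{E}^4$.
   Context: Manifolds and immersions are smooth and connected. $H=\frac12\operatorname{trace}h$ is the mean curvature vector and $\alpha=\|H\|$ the mean curvature, assumed constant on $M$. $\Delta=-\operatorname{trace}\nabla^2$ is the Laplace operator of $M$. The Laplace map is $L:M\to\mathbb{E}^4$, $L(p)=(\Delta x)(p)=-2H(p)$; the Laplace transformation $\mathcal L:M\to L(M)$ is $L$ regarded as a map onto its image. $\mathcal L$ is homothetic if there is a constant $c>0$ with $\langle dL(X),dL(Y)\rangle=c^2\langle X,Y\rangle$ for all tangent vectors $X,Y$ at a common point. The hypersphere may have any center and radius. *)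

(* Defs.v *)
From HB Require Import structures.
From mathcomp Require Import all_boot all_order all_algebra.
From mathcomp Require Import all_classical all_reals all_analysis.

Set Implicit Arguments.
Unset Strict Implicit.
Unset Printing Implicit Defensive.

Import Order.TTheory GRing.Theory Num.Theory.
Import numFieldNormedType.Exports.

Local Open Scope classical_set_scope.
Local Open Scope ring_scope.

(* The library norm on 'rV[R]_n is the sup norm, so the Euclidean structure is
   defined here. *)
Definition dot (R : realType) (n : nat) (u v : 'rV[R]_n) : R :=
  \sum_(i < n) u 0 i * v 0 i.

Definition enorm (R : realType) (n : nat) (u : 'rV[R]_n) : R :=
  Num.sqrt (dot u u).

Definition partial (R : realType) (m : nat) (V : normedModType R) (i : 'I_m)
    (f : 'rV[R]_m -> V) : 'rV[R]_m -> V :=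
  fun z => 'D_(delta_mx 0 i) f z.

Definition iter_partial (R : realType) (m : nat) (V : normedModType R)
    (s : seq 'I_m) (f : 'rV[R]_m -> V) : 'rV[R]_m -> V :=
  foldr (@partial R m V) f s.

(* C^infinity on the open set U: the iterated partial derivatives of all orders
   (including order 0) are Frechet differentiable at every point of U. *)
Definition smooth_on (R : realType) (m : nat) (V : normedModType R)
    (U : set 'rV[R]_m) (f : 'rV[R]_m -> V) : Prop :=
  forall (s : seq 'I_m) (z : 'rV[R]_m),
    U z -> differentiable (iter_partial s f) z.

(* Outside chart_dom and chart_cod the two maps carry no information. *)
Record chart (R : realType) (M : topologicalType) := Chart {
  chart_dom : set M;
  chart_cod : set 'rV[R]_2;
  chart_map :> M -> 'rV[R]_2;
  chart_inv : 'rV[R]_2 -> M;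
  chart_dom_open : open chart_dom;
  chart_cod_open : open chart_cod;
  chart_map_cod : forall p, chart_dom p -> chart_cod (chart_map p);
  chart_inv_dom : forall z, chart_cod z -> chart_dom (chart_inv z);
  chart_mapK : forall p, chart_dom p -> chart_inv (chart_map p) = p;
  chart_invK : forall z, chart_cod z -> chart_map (chart_inv z) = z;
  chart_map_continuous : {within chart_dom, continuous chart_map};
  chart_inv_continuous : {within chart_cod, continuous chart_inv}
}.

Definition compatible (R : realType) (M : topologicalType)
    (phi psi : chart R M) : Prop :=
  smooth_on (phi @` (chart_dom phi `&` chart_dom psi)) (psi \o chart_inv phi).

Record surface (R : realType) := Surface {
  carrier :> topologicalType;
  surface_hausdorff : hausdorff_space carrier;
  surface_second_countable : @second_countable carrier;
  atlas : set (chart R carrier);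
  atlas_cover : forall p, exists2 phi, atlas phi & chart_dom phi p;
  atlas_compatible :
    forall phi psi, atlas phi -> atlas psi -> compatible phi psi
}.

Definition chart_at (R : realType) (M : surface R) (p : M) : chart R M :=
  s2val (cid2 (atlas_cover p)).

Definition in_chart (R : realType) (M : topologicalType) (T : Type)
    (phi : chart R M) (f : M -> T) : 'rV[R]_2 -> T :=
  f \o chart_inv phi.

Definition smooth (R : realType) (M : surface R) (V : normedModType R)
    (f : M -> V) : Prop :=
  forall phi : chart R M, atlas phi -> smooth_on (chart_cod phi) (in_chart phi f).

(* The Jacobian acts on row vectors on the right: 'd f z u = u *m 'J f z, so its
   rows are the partial derivatives, and an injective differential is a
   row-free Jacobian. *)
Definition immersion (R : realType) (n : nat) (M : surface R)
    (x : M -> 'rV[R]_n) : Prop :=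
  smooth x /\
  forall phi : chart R M, atlas phi ->
    forall z, chart_cod phi z -> row_free ('J (in_chart phi x) z).

Section LocalGeometry.
Variables (R : realType) (n : nat).
Implicit Types (G : 'rV[R]_2 -> 'M[R]_2) (F : 'rV[R]_2 -> 'rV[R]_n).

Definition induced_metric F (z : 'rV[R]_2) : 'M[R]_2 :=
  \matrix_(i, j) dot (partial i F z) (partial j F z).

Definition metric_trace (V : lmodType R) (g : 'M[R]_2) (B : 'I_2 -> 'I_2 -> V) : V :=
  \sum_(i < 2) \sum_(j < 2) invmx g i j *: B i j.

Definition christoffel G (k i j : 'I_2) (z : 'rV[R]_2) : R :=
  2^-1 * \sum_(l < 2) invmx (G z) k l *
    (partial i (fun w => G w j l) z + partial j (fun w => G w i l) z
     - partial l (fun w => G w i j) z).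

Definition hessian (V : normedModType R) G (f : 'rV[R]_2 -> V) (z : 'rV[R]_2)
    (i j : 'I_2) : V :=
  partial i (partial j f) z - \sum_(k < 2) christoffel G k i j z *: partial k f z.

Definition laplacian (V : normedModType R) G (f : 'rV[R]_2 -> V)
    (z : 'rV[R]_2) : V :=
  - metric_trace (G z) (hessian G f z).

Definition tangent_part F (z : 'rV[R]_2) (v : 'rV[R]_n) : 'rV[R]_n :=
  \sum_(i < 2) \sum_(j < 2)
    (invmx (induced_metric F z) i j * dot v (partial i F z)) *: partial j F z.

Definition normal_part F (z : 'rV[R]_2) (v : 'rV[R]_n) : 'rV[R]_n :=
  v - tangent_part F z v.

(* h(d_i, d_j): normal component of the flat derivative of d_j F along d_i F *)
Definition second_form F (z : 'rV[R]_2) (i j : 'I_2) : 'rV[R]_n :=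
  normal_part F z (partial i (partial j F) z).

Definition mean_curvature_local F (z : 'rV[R]_2) : 'rV[R]_n :=
  2^-1 *: metric_trace (induced_metric F z) (second_form F z).

(* Orthogonal projection onto the tangent space at y of the hypersphere centred
   at q through y; applied to the flat derivative it gives the Levi-Civita
   connection of that hypersphere. *)
Definition sphere_tangent_part (q y v : 'rV[R]_n) : 'rV[R]_n :=
  v - (dot v (y - q) / dot (y - q) (y - q)) *: (y - q).

Definition sphere_second_form (q : 'rV[R]_n) F (z : 'rV[R]_2) (i j : 'I_2) :
    'rV[R]_n :=
  normal_part F z (sphere_tangent_part q (F z) (partial i (partial j F) z)).

Definition sphere_mean_curvature_local (q : 'rV[R]_n) F (z : 'rV[R]_2) :
    'rV[R]_n :=
  2^-1 *: metric_trace (induced_metric F z) (sphere_second_form q F z).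

End LocalGeometry.

Section Submanifold.
Variables (R : realType) (n : nat) (M : surface R).
Implicit Types x : M -> 'rV[R]_n.

Definition mean_curvature_vector x (p : M) : 'rV[R]_n :=
  mean_curvature_local (in_chart (chart_at p) x) (chart_at p p).

Definition constant_mean_curvature x : Prop :=
  exists alpha : R, forall p : M, enorm (mean_curvature_vector x p) = alpha.

(* Laplace operator of the metric induced by x *)
Definition laplace (V : normedModType R) x (f : M -> V) (p : M) : V :=
  laplacian (induced_metric (in_chart (chart_at p) x))
    (in_chart (chart_at p) f) (chart_at p p).

Definition laplace_map x : M -> 'rV[R]_n := laplace x x.

(* A map L : M -> E^n, regarded as a map onto its image, is homothetic for the
   metric induced by x.  Tangent vectors at p are represented by their
   components u, v in a chart around p. *)
Definition homothetic x (L : M -> 'rV[R]_n) : Prop :=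
  exists2 c : R, 0 < c &
    forall phi : chart R M, atlas phi ->
    forall p : M, chart_dom phi p ->
    forall u v : 'rV[R]_2,
      dot ('d (in_chart phi L) (phi p) u) ('d (in_chart phi L) (phi p) v) =
      c ^+ 2 * dot ('d (in_chart phi x) (phi p) u) ('d (in_chart phi x) (phi p) v).

Definition homothetic_laplace_transformation x : Prop :=
  homothetic x (laplace_map x).

Definition hypersphere (q : 'rV[R]_n) (r : R) : set 'rV[R]_n :=
  [set y | enorm (y - q) = r].

Definition sphere_mean_curvature_vector (q : 'rV[R]_n) x (p : M) : 'rV[R]_n :=
  sphere_mean_curvature_local q (in_chart (chart_at p) x) (chart_at p p).

Definition minimal_in_hypersphere x : Prop :=
  exists (q : 'rV[R]_n) (r : R),
    [/\ 0 < r, forall p, hypersphere q r (x p) &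
        forall p, sphere_mean_curvature_vector q x p = 0].

End Submanifold.

(* Main.v *)
(* In a chart write N for the mean curvature vector, A = |N|^2, g for the metric,
   k = c / 2 and y = N + k x.  Since E^4 leaves only one normal direction
   orthogonal to N, the homothety condition <N_i, N_j> = k^2 g_ij forces the
   Gram matrix of (y_1, y_2) to have determinant 0, and its g-trace is the
   constant 4 k (k - A).

   Suppose y_a <> 0 somewhere.  Then y_b = t y_a nearby, and D = d_b - t d_a
   annihilates y.  Differentiating the orthogonality relations of v = y_a with N
   and with X2 = D x repeatedly along D shows that q = D X2 is orthogonal to v and
   to d_a v.  Expanding the product of q with the derivative of v along
   E = d_a + r D (r chosen so that X1 = E x is orthogonal to X2) in the orthogonal
   frame X1, X2, N, v - 2 (k - A) X1 gives a sum of a nonpositive and a negative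
   term, a contradiction.

   So y is constant: x moves on the sphere about y / k, and N points to its centre,
   which is minimality in that sphere.  Conversely, for a minimal surface of a
   sphere, N = - r^-2 (x - q), so the Laplace map is a similarity of x. *)
From HB Require Import structures.
Require Import Defs.
From mathcomp Require Import all_boot all_order all_algebra.
From mathcomp Require Import all_classical all_reals all_analysis.
From mathcomp Require Import ring lra.
Import Order.TTheory GRing.Theory Num.Theory.
Import numFieldNormedType.Exports.
Local Open Scope classical_set_scope.
Local Open Scope ring_scope.
Set Implicit Arguments.
Unset Strict Implicit.

(** * Differential calculus in coordinates *)

(** Geometry behind the contradiction: where y_a <> 0 the map y runs locally along a curve, and x -
    y / k = - N / k has constant length sqrt A / k and is orthogonal to the tangent v of that curve.
    The surface therefore lies in a tube of constant radius, and D differentiates along the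
    spherical slices of the tube. Two facts collide: a curve tangent to D bends towards the centre
    of its slice, and the trace of the second fundamental form vanishes in the normal direction
    orthogonal to N.

    The repeated differentiation along D takes the place of a normal frame and of the Codazzi
    equation. What it feeds on is that D kills y but does not commute with d_a: the commutator d_a D
    - D d_a is - (d_a t) d_a.

    A second obstacle lies in the definitions: the Laplace map at p is computed in a chart chosen
    for p, so before it can be differentiated in one fixed chart, the mean curvature vector must be
    shown not to depend on the chart. *)

Section Diff.
Context {R : realType} {V W : normedModType R}.

(** The little-o expansion only sees a neighbourhood, so [g] inherits that of [f]; [diff_unique]
    then makes its linear part the differential of [g]. *)
Lemma differentiable_near_eq (f g : V -> W) z :
  (\forall w \near z, f w = g w) -> differentiable f z -> differentiable g z.
Proof.
move=> fg df.
have [cf ef] := (diff_locallyP _ _).1 df.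
have fgz : f z = g z := nbhs_singleton fg.
have eg : g \o shift z = cst (g z) + 'd f z +o_ 0 id.
  apply/eqaddoP => e e0.
  move/eqaddoP: ef => /(_ e e0).
  have fg0 : \forall h \near (0 : V), f (h + z) = g (h + z).
    by move: fg; rewrite [X in X -> _](near_shift 0) subr0.
  apply: filter_app; near=> h => /=; rewrite !fctE /= -fgz.
  by rewrite (near fg0 h).
apply/diff_locallyP.
have E := diff_unique cf eg.
by rewrite E.
Unshelve. all: by end_near. Qed.
End Diff.

Section Partial.
Context {R : realType} {m : nat}.
Implicit Types (U : set 'rV[R]_m) (i : 'I_m).

Section V.
Context {V : normedModType R}.
Implicit Types f g : 'rV[R]_m -> V.

Lemma partialE i f z : differentiable f z -> partial i f z = 'd f z (delta_mx 0 i).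
Proof. by move=> df; rewrite /partial deriveE. Qed.

Lemma near_partial i f g z : (\forall w \near z, f w = g w) ->
  partial i f z = partial i g z.
Proof. exact: near_eq_derive. Qed.

Lemma partial_ext i U f g z : open U -> U z -> (forall w, U w -> f w = g w) ->
  partial i f z = partial i g z.
Proof.
move=> oU Uz fg; apply: near_partial.
by have := open_nbhs_nbhs (conj oU Uz); apply: filterS.
Qed.

Lemma differentiable_ext U f g z : open U -> U z -> (forall w, U w -> f w = g w) ->
  differentiable f z -> differentiable g z.
Proof.
move=> oU Uz fg; apply: differentiable_near_eq.
by have := open_nbhs_nbhs (conj oU Uz); apply: filterS.
Qed.

Lemma partialD i f g z : differentiable f z -> differentiable g z ->
  partial i (fun w => f w + g w) z = partial i f z + partial i g z.
Proof. by move=> df dg; rewrite /partial deriveD //; exact: diff_derivable. Qed.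

Lemma partialZ i (k : R) f z : differentiable f z ->
  partial i (fun w => k *: f w) z = k *: partial i f z.
Proof. by move=> df; rewrite /partial deriveZ //; exact: diff_derivable. Qed.

Lemma partial_cst i (c : V) z : partial i (fun=> c) z = 0.
Proof. by rewrite /partial derive_cst. Qed.

Lemma diff_partial f z u : differentiable f z ->
  'd f z u = \sum_i u 0 i *: partial i f z.
Proof.
move=> df; rewrite {1}[u]row_sum_delta linear_sum; apply: eq_bigr => i _.
by rewrite linearZ partialE.
Qed.
End V.

Lemma partialM i (f g : 'rV[R]_m -> R) z :
  differentiable f z -> differentiable g z ->
  partial i (fun w => f w * g w) z = partial i f z * g z + f z * partial i g z.
Proof.
move=> df dg; rewrite /partial deriveM; try exact: diff_derivable.
by rewrite addrC /GRing.scale /= [g z * _]mulrC.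
Qed.

Lemma partialV i (f : 'rV[R]_m -> R) z : f z != 0 -> differentiable f z ->
  partial i (fun w => (f w)^-1) z = - (partial i f z * ((f z)^-1 * (f z)^-1)).
Proof.
move=> fz df; rewrite /partial deriveV //; last exact: diff_derivable.
by rewrite /GRing.scale /= expr2 invfM mulNr mulrC.
Qed.

Lemma partial_coord (n : nat) i (f : 'rV[R]_m -> 'rV[R]_n) k z : differentiable f z ->
  partial i f z 0 k = partial i (fun w => f w 0 k) z.
Proof.
by move=> df; rewrite /partial derive_mx ?mxE //; exact: diff_derivable.
Qed.

Lemma differentiable_coordP n (f : 'rV[R]_m -> 'rV[R]_n) z :
  differentiable f z <-> forall k, differentiable (fun w => f w 0 k) z.
Proof.
split=> [df k|df].
  have -> : (fun w => f w 0 k) = (fun v : 'rV[R]_n => v 0 k) \o f by [].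
  by apply: differentiable_comp => //; exact: differentiable_coord.
have -> : f = \sum_(k < n) (fun w => f w 0 k *: delta_mx 0 k).
  by apply/funext => w; rewrite fct_sumE {1}[f w]row_sum_delta.
by apply: differentiable_sum => k; apply: differentiableZl.
Qed.

Lemma partial_sum n i (h : 'I_n -> 'rV[R]_m -> R) z :
  (forall k, differentiable (h k) z) ->
  partial i (fun w => \sum_k h k w) z = \sum_k partial i (h k) z.
Proof.
move=> dh; rewrite /partial -derive_sum => [|k]; last exact: diff_derivable.
by congr ('D_ _ _ _); apply/funext => w; rewrite fct_sumE.
Qed.

Lemma partial_dot n i (f g : 'rV[R]_m -> 'rV[R]_n) z :
  differentiable f z -> differentiable g z ->
  partial i (fun w => dot (f w) (g w)) z =
  dot (partial i f z) (g z) + dot (f z) (partial i g z).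
Proof.
move=> df dg.
have dfk := (differentiable_coordP _ _).1 df.
have dgk := (differentiable_coordP _ _).1 dg.
rewrite /dot partial_sum => [|k]; last exact: differentiableM.
rewrite -big_split; apply: eq_bigr => k _ /=.
by rewrite partialM // !partial_coord.
Qed.

Lemma differentiable_scale n (k : 'rV[R]_m -> R) (f : 'rV[R]_m -> 'rV[R]_n) z :
  differentiable k z -> differentiable f z ->
  differentiable (fun w => k w *: f w) z.
Proof.
move=> dk /differentiable_coordP df; apply/differentiable_coordP => j.
under eq_fun do rewrite mxE; exact: differentiableM.
Qed.

Lemma partial_scale n i (k : 'rV[R]_m -> R) (f : 'rV[R]_m -> 'rV[R]_n) z :
  differentiable k z -> differentiable f z ->
  partial i (fun w => k w *: f w) z = partial i k z *: f z + k z *: partial i f z.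
Proof.
move=> dk df; have dfk := (differentiable_coordP _ _).1 df.
apply/rowP => j; rewrite partial_coord; last exact: differentiable_scale.
have -> : (fun w => (k w *: f w) 0 j) = (fun w => k w * f w 0 j).
  by apply/funext => w; rewrite mxE.
by rewrite partialM // !mxE (partial_coord _ _ df).
Qed.

End Partial.

(** * Closure properties of smooth maps *)

Section Smooth.
Context {R : realType} {m : nat}.
Implicit Types (U : set 'rV[R]_m) (i : 'I_m).

(** [iter_partial] is a right fold, so the derivative taken first is the last index of the list:
    hence [rcons]. *)
Lemma smooth_onP (V : normedModType R) U (f : 'rV[R]_m -> V) :
  smooth_on U f <->
  (forall z, U z -> differentiable f z) /\ forall i, smooth_on U (partial i f).
Proof.
split=> [sf|[df sf] s].
  split=> [z Uz|i s z Uz]; first exact: (sf [::]).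
  by have := sf (rcons s i) z Uz; rewrite /iter_partial foldr_rcons.
elim/last_ind: s => [//|s i _] z Uz.
by rewrite /iter_partial foldr_rcons; exact: sf.
Qed.

(** Finite-order smoothness. The product and quotient rules mix functions with their derivatives, so
    an induction on the list of indices does not close; an induction on the order [k] does, with
    [CnW] levelling the orders. *)
Fixpoint Cn (V : normedModType R) (k : nat) U (f : 'rV[R]_m -> V) : Prop :=
  (forall z, U z -> differentiable f z) /\
  if k is k'.+1 then forall i, Cn k' U (partial i f) else True.

Lemma smooth_onC (V : normedModType R) U (f : 'rV[R]_m -> V) :
  smooth_on U f <-> forall k, Cn k U f.
Proof.
split=> [sf k|Cf].
  elim: k f sf => [|k IH] f /smooth_onP[df sf]; split => // i.
  exact: IH.
move=> s; elim/last_ind: s f Cf => [|s i IH] f Cf z Uz.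
  by have [/(_ z Uz)] := Cf 0%N.
rewrite /iter_partial foldr_rcons; apply: IH => // k.
by have [_ /(_ i)] := Cf k.+1.
Qed.

Lemma Cn_diff (V : normedModType R) U (f : 'rV[R]_m -> V) k z : Cn k U f -> U z -> differentiable f z.
Proof. by case: k => [|k] [df _]; apply: df. Qed.

Lemma CnW (V : normedModType R) k U (f : 'rV[R]_m -> V) : Cn k.+1 U f -> Cn k U f.
Proof.
elim: k f => [|k IH] f [df Cf]; split => // i; apply: IH; exact: Cf.
Qed.

Lemma Cn_ext (V : normedModType R) k U (f g : 'rV[R]_m -> V) : open U ->
  (forall z, U z -> f z = g z) -> Cn k U f -> Cn k U g.
Proof.
move=> oU; elim: k f g => [|k IH] f g fg [df Cf]; split.
- move=> z Uz; exact: (differentiable_ext oU Uz fg (df z Uz)).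
- by [].
- move=> z Uz; exact: (differentiable_ext oU Uz fg (df z Uz)).
- move=> i; apply: IH (Cf i) => z Uz; exact: partial_ext oU Uz fg.
Qed.

Lemma Cn_cst (V : normedModType R) k U (c : V) : Cn k U (fun=> c).
Proof.
elim: k c => [|k IH] c; split=> //; try by move=> z _; exact: differentiable_cst.
move=> i; have -> : partial i (fun=> c) = (fun=> 0) by apply/funext => z; exact: partial_cst.
exact: IH.
Qed.

Lemma CnD (V : normedModType R) k U (f g : 'rV[R]_m -> V) : open U ->
  Cn k U f -> Cn k U g -> Cn k U (fun z => f z + g z).
Proof.
move=> oU; elim: k f g => [|k IH] f g [df Cf] [dg Cg]; split=> //;
  try by move=> z Uz; apply: differentiableD; [exact: df|exact: dg].
move=> i; apply: Cn_ext (IH _ _ (Cf i) (Cg i)) => // z Uz.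
by rewrite partialD //; [exact: df|exact: dg].
Qed.

Lemma CnM k U (f g : 'rV[R]_m -> R) : open U ->
  Cn k U f -> Cn k U g -> Cn k U (fun z => f z * g z).
Proof.
move=> oU; elim: k f g => [|k IH] f g Cf Cg; split=> //;
  try by move=> z Uz; apply: differentiableM; [exact: Cn_diff Cf Uz|exact: Cn_diff Cg Uz].
move=> i; have [_ Cf'] := Cf; have [_ Cg'] := Cg.
apply: Cn_ext (CnD oU (IH _ _ (Cf' i) (CnW Cg)) (IH _ _ (CnW Cf) (Cg' i))) => // z Uz.
by rewrite partialM //; [exact: Cn_diff Cf Uz|exact: Cn_diff Cg Uz].
Qed.

Lemma CnV k U (f : 'rV[R]_m -> R) : open U -> (forall z, U z -> f z != 0) ->
  Cn k U f -> Cn k U (fun z => (f z)^-1).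
Proof.
move=> oU f0; elim: k f f0 => [|k IH] f f0 Cf; split=> //;
  try by move=> z Uz; apply: differentiableV; [exact: Cn_diff Cf Uz|exact: f0].
move=> i; have [_ Cf'] := Cf; have IV := IH _ f0 (CnW Cf).
have C := CnM oU (Cn_cst k U (-1 : R)) (CnM oU (Cf' i) (CnM oU IV IV)).
apply: (Cn_ext oU _ C) => z Uz.
by rewrite partialV ?mulN1r //; [exact: f0|exact: Cn_diff Cf Uz].
Qed.

Lemma Cn_coordP n k U (f : 'rV[R]_m -> 'rV[R]_n) : open U ->
  Cn k U f <-> forall j, Cn k U (fun z => f z 0 j).
Proof.
move=> oU; split.
  move=> + j; elim: k f => [|k IH] f [df Cf]; split=> //;
    try by move=> z Uz; exact: ((differentiable_coordP _ _).1 (df z Uz) j).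
  by move=> i; apply: Cn_ext (IH _ (Cf i)) => // z Uz; rewrite partial_coord //; exact: df.
elim: k f => [|k IH] f Cf.
  by split=> // z Uz; apply/differentiable_coordP => j; have [/(_ z Uz)] := Cf j.
have df z : U z -> differentiable f z.
  by move=> Uz; apply/differentiable_coordP => j; have [/(_ z Uz)] := Cf j.
split=> // i; apply: IH => j.
have [_ /(_ i)] := Cf j; apply: Cn_ext => // z Uz.
by rewrite partial_coord //; exact: df.
Qed.

Section Ops.
Context {U : set 'rV[R]_m}.
Hypothesis oU : open U.

Lemma smooth_diff (V : normedModType R) (f : 'rV[R]_m -> V) z : smooth_on U f -> U z -> differentiable f z.
Proof. by move=> /smooth_onP[df _]; exact: df. Qed.

Lemma smooth_partial (V : normedModType R) i (f : 'rV[R]_m -> V) : smooth_on U f -> smooth_on U (partial i f).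
Proof. by move=> /smooth_onP[_ sf]; exact: sf. Qed.

Lemma smooth_ext (V : normedModType R) (f g : 'rV[R]_m -> V) :
  (forall z, U z -> f z = g z) -> smooth_on U f -> smooth_on U g.
Proof.
by move=> fg /smooth_onC Cf; apply/smooth_onC => k; exact: Cn_ext oU fg (Cf k).
Qed.

Lemma smooth_cst (V : normedModType R) (c : V) : smooth_on U (fun=> c).
Proof. by apply/smooth_onC => k; exact: Cn_cst. Qed.

Lemma smoothD (V : normedModType R) (f g : 'rV[R]_m -> V) : smooth_on U f -> smooth_on U g ->
  smooth_on U (fun z => f z + g z).
Proof.
by move=> /smooth_onC Cf /smooth_onC Cg; apply/smooth_onC => k; exact: CnD.
Qed.

Lemma smoothM (f g : 'rV[R]_m -> R) : smooth_on U f -> smooth_on U g ->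
  smooth_on U (fun z => f z * g z).
Proof.
by move=> /smooth_onC Cf /smooth_onC Cg; apply/smooth_onC => k; exact: CnM.
Qed.

Lemma smoothV (f : 'rV[R]_m -> R) : (forall z, U z -> f z != 0) ->
  smooth_on U f -> smooth_on U (fun z => (f z)^-1).
Proof.
by move=> f0 /smooth_onC Cf; apply/smooth_onC => k; exact: CnV.
Qed.

Lemma smooth_coordP n (f : 'rV[R]_m -> 'rV[R]_n) :
  smooth_on U f <-> forall j, smooth_on U (fun z => f z 0 j).
Proof.
split=> [/smooth_onC Cf j|sf]; apply/smooth_onC => k.
  exact: ((Cn_coordP k f oU).1 (Cf k)).
by apply/(Cn_coordP k f oU) => j; move/smooth_onC: (sf j).
Qed.

Lemma smooth_scale n (k : 'rV[R]_m -> R) (f : 'rV[R]_m -> 'rV[R]_n) :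
  smooth_on U k -> smooth_on U f -> smooth_on U (fun z => k z *: f z).
Proof.
move=> sk /smooth_coordP sf; apply/smooth_coordP => j.
under eq_fun do rewrite mxE; exact: smoothM.
Qed.

Lemma smoothN n (f : 'rV[R]_m -> 'rV[R]_n) : smooth_on U f -> smooth_on U (fun z => - f z).
Proof.
move=> sf; under eq_fun do rewrite -scaleN1r.
by apply: smooth_scale => //; exact: smooth_cst.
Qed.

Lemma smooth_sum (V : normedModType R) n (h : 'I_n -> 'rV[R]_m -> V) :
  (forall j, smooth_on U (h j)) -> smooth_on U (fun z => \sum_j h j z).
Proof.
elim: n h => [|n IH] h sh.
  under eq_fun do rewrite big_ord0; exact: smooth_cst.
under eq_fun do rewrite big_ord_recl.
by apply: smoothD => //; apply: IH.
Qed.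

Lemma smooth_dot n (f g : 'rV[R]_m -> 'rV[R]_n) :
  smooth_on U f -> smooth_on U g -> smooth_on U (fun z => dot (f z) (g z)).
Proof.
move=> /smooth_coordP sf /smooth_coordP sg; apply: smooth_sum => j.
exact: smoothM.
Qed.
End Ops.

Lemma smooth_sub (V : normedModType R) U U' (f : 'rV[R]_m -> V) : U' `<=` U -> smooth_on U f -> smooth_on U' f.
Proof. by move=> UU sf s z /UU; exact: sf. Qed.

End Smooth.

(** * Symmetry of second derivatives *)

Section Lines.
Context {R : realType} {V : normedModType R}.
Implicit Types (f : V -> R) (a b c z : V).

Lemma is_derive_line f a c (s : R) : differentiable f (c + s *: a) ->
  is_derive s (1 : R) (fun t : R => f (c + t *: a)) ('D_a f (c + s *: a)).
Proof.
move=> df.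
have dl : is_diff s (fun t : R => c + t *: a) (fun t : R => t *: a).
  by apply: is_diff_eq; apply/funext => t; rewrite !fctE add0r.
have ddl : differentiable (fun t : R => c + t *: a) s := @ex_diff _ _ _ _ _ _ _ dl.
have dfc : differentiable (f \o (fun t : R => c + t *: a)) s.
  exact: differentiable_comp.
apply: DeriveDef; first exact: diff_derivable.
rewrite (deriveE _ dfc) (diff_comp ddl df) /=.
by rewrite (@diff_val _ _ _ _ _ _ _ dl) scale1r deriveE.
Qed.

Lemma continuous_line f a c (u v : R) :
  (forall s, s \in `[u, v]%R -> differentiable f (c + s *: a)) ->
  {within `[u, v]%classic, continuous (fun t : R => f (c + t *: a))}.
Proof.
move=> df; apply: derivable_within_continuous => s su.
by have [] := is_derive_line (df s su).
Qed.

(** Young's argument: the mean value theorem along [a] turns the second difference into an increment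
    of ['D_a f] along [b], which the first-order expansion of ['D_a f] at [z] evaluates. *)
Lemma second_difference f a b z : (\forall w \near z, differentiable f w) ->
  differentiable ('D_a f) z -> forall e : R, 0 < e ->
  exists2 d : R, 0 < d & forall h : R, 0 < h < d ->
  `|f (z + h *: b + h *: a) - f (z + h *: a) - f (z + h *: b) + f z
    - h ^+ 2 * 'D_b ('D_a f) z| <= e * h ^+ 2.
Proof.
move=> nf dg e e0; set g := 'D_a f.
(* [C] serves twice: [h * C < r] keeps the parallelogram in the ball of the expansion, and [C]
   dominates the two errors proportional to [h * (|a| + |b|)]. The summand [1] keeps it positive. *)
pose C : R := 2 * `|a| + 2 * `|b| + 1.
have C0 : 0 < C by rewrite /C; have := normr_ge0 a; have := normr_ge0 b; lra.
have eC : 0 < e / C by exact: divr_gt0.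
have [_ /eqaddoP /(_ _ eC) ng] := (diff_locallyP _ _).1 dg.
move: nf ng; rewrite (near_shift 0) subr0 => nf ng.
have [r /= r0 Hr] := (nbhs_ballP _ _).1 (filterI nf ng).
exists (r / C); first exact: divr_gt0.
move=> h /andP[h0 hr].
have bd (s t : R) : 0 <= s <= h -> 0 <= t <= h -> `|t *: b + s *: a| < r /\ `|t *: b + s *: a| <= h * (`|a| + `|b|).
  move=> /andP[s0 sh] /andP[t0 th].
  have L : `|t *: b + s *: a| <= h * (`|a| + `|b|).
    apply: le_trans (ler_normD _ _) _; rewrite !normrZ !ger0_norm //.
    by rewrite mulrDr addrC lerD // ler_wpM2r.
  split=> //; apply: le_lt_trans L _.
  have : h * C < r by rewrite -ltr_pdivlMr.
  by apply: le_lt_trans; rewrite ler_wpM2l ?ltW // /C; have := normr_ge0 a; have := normr_ge0 b; lra.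
have dfs (s t : R) : 0 <= s <= h -> 0 <= t <= h -> differentiable f (z + t *: b + s *: a).
  move=> s0 t0; have [L _] := bd s t s0 t0.
  have [] := Hr (t *: b + s *: a).
    by rewrite -ball_normE /= sub0r normrN.
  by rewrite /= addrC addrA.
have gs (s t : R) : 0 <= s <= h -> 0 <= t <= h ->
    `|g (z + t *: b + s *: a) - g z - 'd g z (t *: b + s *: a)| <= e / C * (h * (`|a| + `|b|)).
  move=> s0 t0; have [L L2] := bd s t s0 t0.
  have Bw : ball (0 : V) r (t *: b + s *: a) by rewrite -ball_normE /= sub0r normrN.
  have [_ +] := Hr _ Bw; rewrite !fctE /= => H.
  have -> : z + t *: b + s *: a = t *: b + s *: a + z by rewrite -addrA addrC.
  rewrite -[X in `|X|]addrA -opprD; apply: le_trans H _.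
  by rewrite ler_pM2l.
have h0h : 0 <= h <= h by rewrite lexx ltW.
have z0h : 0 <= (0 : R) <= h by rewrite lexx ltW.
(* The term [0 *: b] gives both summands the shape [z + t *: b + s *: a], so that [dfs] covers
   [t = h] and [t = 0] alike. *)
pose phi (s : R) := f (z + h *: b + s *: a) - f (z + 0 *: b + s *: a).
have D1 (s : R) : s \in `]0, h[%R ->
    is_derive s (1 : R) phi (g (z + h *: b + s *: a) - g (z + 0 *: b + s *: a)).
  rewrite in_itv /= => /andP[s0 sh].
  have s0h : 0 <= s <= h by rewrite !ltW.
  by apply: is_deriveB; apply: is_derive_line; exact: dfs.
have D2 : {within `[0, h]%classic, continuous phi}.
  move=> x; apply: continuousB; apply: continuous_line => s; rewrite in_itv /= => sh; exact: dfs.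
have [s] := MVT h0 D1 D2.
rewrite in_itv /= => /andP[s0 sh].
have s0h : 0 <= s <= h by rewrite !ltW.
rewrite /phi !scale0r !addr0 subr0 => E.
have -> : f (z + h *: b + h *: a) - f (z + h *: a) - f (z + h *: b) + f z =
   (g (z + h *: b + s *: a) - g (z + s *: a)) * h.
  by rewrite -E; ring.
have Dl (t : R) : 'd g z (t *: b + s *: a) = t * 'D_b g z + s * 'd g z a.
  by rewrite linearD !linearZ deriveE.
have G1 := gs s h s0h h0h; have G2 := gs s 0 s0h z0h.
rewrite Dl in G1; rewrite Dl mul0r add0r scale0r addr0 in G2.
move: G1 G2.
set D := 'D_b g z; set A := 'd g z a; set g0 := g z; set g1 := g _; set g2 := g _ => G1 G2.
have -> : (g1 - g2) * h - h ^+ 2 * D =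
   h * ((g1 - g0 - (h * D + s * A)) - (g2 - g0 - s * A)) by ring.
rewrite normrM gtr0_norm //.
have -> : e * h ^+ 2 = h * (e * h) by ring.
rewrite ler_pM2l //.
apply: le_trans (ler_normB _ _) _.
apply: le_trans (lerD G1 G2) _.
have -> : e / C * (h * (`|a| + `|b|)) + e / C * (h * (`|a| + `|b|)) = (e * h) * ((2 * `|a| + 2 * `|b|) / C) by ring.
rewrite ger_pMr; last exact: mulr_gt0.
by rewrite ler_pdivrMr // mul1r /C; lra.
Qed.

(** The second difference is symmetric in [a] and [b], so both mixed derivatives lie within [e / 2]
    of its quotient by [h ^+ 2]. *)
Lemma derive_comm f a b z : (\forall w \near z, differentiable f w) ->
  differentiable ('D_a f) z -> differentiable ('D_b f) z ->
  'D_a ('D_b f) z = 'D_b ('D_a f) z.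
Proof.
move=> nf da db; apply/eqP; rewrite -subr_eq0 -normr_le0.
apply/ler_addgt0Pr => e e0; rewrite add0r.
have e2 : 0 < e / 2 by rewrite divr_gt0.
have [d1 d10 H1] := second_difference b nf da e2.
have [d2 d20 H2] := second_difference a nf db e2.
pose h := Num.min d1 d2 / 2.
have m0 : 0 < Num.min d1 d2 by rewrite lt_min d10.
have h0 : 0 < h by rewrite divr_gt0.
have hm : h < Num.min d1 d2 by rewrite /h; lra.
move: (hm); rewrite lt_min => /andP[hd1 hd2].
have {H1} := H1 h; rewrite h0 hd1 => /(_ isT) H1.
have {H2} := H2 h; rewrite h0 hd2 => /(_ isT) H2.
have h2 : 0 < h ^+ 2 by exact: exprn_gt0.
rewrite -(ler_pM2l h2) -{1}(gtr0_norm h2) -normrM.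
rewrite (addrAC z (h *: a)) in H2.
move: H1 H2; set X := f _; set Y1 := f _; set Y2 := f _; set D1 := 'D_b _ z; set D2 := 'D_a _ z => H1 H2.
have -> : h ^+ 2 * (D2 - D1) = (X - Y1 - Y2 + f z - h ^+ 2 * D1) - (X - Y2 - Y1 + f z - h ^+ 2 * D2) by ring.
apply: le_trans (ler_normB _ _) _; apply: le_trans (lerD H1 H2) _.
by rewrite -mulrDl -splitr mulrC.
Qed.

Lemma ball_cst f z (r : R) : (forall w, ball z r w -> differentiable f w) ->
  (forall w, ball z r w -> forall v, 'd f w v = 0) ->
  forall w, ball z r w -> f w = f z.
Proof.
move=> df f0 w zw.
have lb (s : R) : 0 <= s <= 1 -> ball z r (z + s *: (w - z)).
  move=> /andP[s0 s1]; move: zw; rewrite -!ball_normE /= opprD addNKr normrN normrZ distrC.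
  by apply: le_lt_trans; rewrite ger0_norm // ler_piMl.
have D1 (s : R) : s \in `]0, 1[%R ->
    is_derive s (1 : R) (fun s => f (z + s *: (w - z))) ('D_(w - z) f (z + s *: (w - z))).
  rewrite in_itv /= => /andP[s0 s1].
  by apply: is_derive_line; apply: df; apply: lb; rewrite !ltW.
have D2 : {within `[0, 1]%classic, continuous (fun s : R => f (z + s *: (w - z)))}.
  by apply: continuous_line => s; rewrite in_itv /= => s01; apply: df; exact: lb.
have [s] := MVT ltr01 D1 D2.
rewrite in_itv /= => /andP[s0 s1].
have bs : ball z r (z + s *: (w - z)) by apply: lb; rewrite !ltW.
rewrite deriveE ?f0 //; last exact: df.
by rewrite scale1r scale0r addr0 (addrC z) subrK mul0r => /eqP; rewrite subr_eq0 => /eqP.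
Qed.
End Lines.

Section PartialComm.
Context {R : realType} {m : nat}.
Implicit Types (U : set 'rV[R]_m) (i j : 'I_m).

Lemma partial_comm n U (f : 'rV[R]_m -> 'rV[R]_n) i j z : open U -> smooth_on U f -> U z ->
  partial i (partial j f) z = partial j (partial i f) z.
Proof.
move=> oU sf Uz; apply/rowP => k.
have Ec i' j' : partial i' (partial j' f) z 0 k = partial i' (fun w => partial j' f w 0 k) z.
  by apply: partial_coord; apply: smooth_diff Uz; exact: smooth_partial.
apply: etrans (Ec i j) (etrans _ (esym (Ec j i))).
have sfk : smooth_on U (fun w => f w 0 k) by exact: ((smooth_coordP oU f).1 sf).
have E i' : forall w, U w -> partial i' f w 0 k = partial i' (fun w => f w 0 k) w.
  by move=> w Uw; rewrite (partial_coord _ _ (smooth_diff sf Uw)).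
apply: etrans (partial_ext i oU Uz (E j)) (etrans _ (esym (partial_ext j oU Uz (E i)))).
apply: derive_comm; last 2 first.
- exact: (smooth_diff (smooth_partial i sfk) Uz).
- exact: (smooth_diff (smooth_partial j sfk) Uz).
have := open_nbhs_nbhs (conj oU Uz); apply: filterS => w Uw; exact: (smooth_diff sfk Uw).
Qed.
End PartialComm.

(** * Euclidean linear algebra *)

Section Dot.
Context {R : realType} {n : nat}.
Implicit Types (u v w : 'rV[R]_n) (k : R).

Lemma dotC u v : dot u v = dot v u.
Proof. by apply: eq_bigr => i _; rewrite mulrC. Qed.
Lemma dotDl u v w : dot (u + v) w = dot u w + dot v w.
Proof. by rewrite -big_split; apply: eq_bigr => i _; rewrite mxE mulrDl. Qed.
Lemma dotZl k u w : dot (k *: u) w = k * dot u w.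
Proof. by rewrite /dot mulr_sumr; apply: eq_bigr => i _; rewrite mxE mulrA. Qed.
Lemma dotNl u w : dot (- u) w = - dot u w.
Proof. by rewrite -scaleN1r dotZl mulN1r. Qed.
Lemma dotDr u v w : dot w (u + v) = dot w u + dot w v.
Proof. by rewrite !(dotC w) dotDl. Qed.
Lemma dotZr k u w : dot w (k *: u) = k * dot w u.
Proof. by rewrite !(dotC w) dotZl. Qed.
Lemma dotNr u w : dot w (- u) = - dot w u.
Proof. by rewrite !(dotC w) dotNl. Qed.
Lemma dot0l w : dot 0 w = 0.
Proof. by rewrite -(scale0r 0) dotZl mul0r. Qed.
Definition dotE := (dotDl, dotDr, dotZl, dotZr, dotNl, dotNr).

Lemma dot_suml (I : finType) (F : I -> 'rV[R]_n) w : dot (\sum_i F i) w = \sum_i dot (F i) w.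
Proof. by apply: (big_morph (fun u => dot u w)) => [u v|]; [rewrite dotDl|rewrite dot0l]. Qed.
Lemma dot_sumr (I : finType) (F : I -> 'rV[R]_n) w : dot w (\sum_i F i) = \sum_i dot w (F i).
Proof. by rewrite dotC dot_suml; apply: eq_bigr => i _; rewrite dotC. Qed.

Lemma dot_ge0 u : 0 <= dot u u.
Proof. by apply: sumr_ge0 => i _; rewrite -expr2 sqr_ge0. Qed.
Lemma dot_eq0 u : (dot u u == 0) = (u == 0).
Proof.
apply/eqP/eqP => [|->]; last exact: dot0l.
move=> /eqP; rewrite psumr_eq0 => [|i _]; last by rewrite -expr2 sqr_ge0.
move=> /allP H; apply/rowP => i; rewrite mxE.
by have /= := H i (mem_index_enum i); rewrite mulf_eq0 orbb => /eqP.
Qed.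
Lemma dot_gt0 u : (0 < dot u u) = (u != 0).
Proof. by rewrite lt_neqAle dot_ge0 andbT eq_sym dot_eq0. Qed.

Lemma dotEmx u v : dot u v = (u *m v^T) 0 0.
Proof. by rewrite mxE; apply: eq_bigr => i _; rewrite mxE. Qed.

(** Orthogonality says that [B^T *m D] is a right inverse of the square matrix [B]; it is then a
    left inverse too, and the identity [B^T *m D *m B = 1] is inserted between [u] and [v^T]. *)
Lemma parseval (b : 'I_n -> 'rV[R]_n) u v :
  (forall i, b i != 0) -> (forall i j, i != j -> dot (b i) (b j) = 0) ->
  dot u v = \sum_i dot u (b i) * dot v (b i) / dot (b i) (b i).
Proof.
move=> b0 bo; pose B := \matrix_i b i.
pose D := diag_mx (\row_i (dot (b i) (b i))^-1).
have E : B *m (B^T *m D) = 1%:M.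
  apply/matrixP => i j; rewrite mulmxA /D mul_mx_diag !mxE.
  have -> : \sum_k B i k * B^T k j = dot (b i) (b j).
    by apply: eq_bigr => k _; rewrite !mxE.
  have [->|ij] := eqVneq i j; last by rewrite bo // mul0r.
  by rewrite mulfV // dot_eq0.
have E2 := mulmx1C E.
rewrite dotEmx -[u in LHS]mulmx1 -E2 !mulmxA -mulmxA mxE; apply: eq_bigr => i _.
have -> : (B *m v^T) i 0 = dot v (b i).
  by rewrite mxE; apply: eq_bigr => k _; rewrite !mxE mulrC.
rewrite /D mul_mx_diag !mxE.
have -> : \sum_j u 0 j * B^T j i = dot u (b i).
  by apply: eq_bigr => k _; rewrite !mxE.
by rewrite mulrAC.
Qed.

Lemma exists_orthogonal p (B : 'M[R]_(p, n)) : (p < n)%N ->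
  exists2 u : 'rV[R]_n, u != 0 & forall i, dot u (row i B) = 0.
Proof.
move=> kn; pose K := kermx B^T.
have K0 : K != 0.
  rewrite -mxrank_eq0 mxrank_ker subn_eq0 -ltnNge.
  exact: leq_ltn_trans (rank_leq_col _) kn.
exists (nz_row K); first by rewrite nz_row_eq0.
move=> i; have /sub_kermxP : (nz_row K <= kermx B^T)%MS by exact: nz_row_sub.
move=> /(congr1 (fun M : 'rV[R]_p => M 0 i)); rewrite !mxE => E.
by rewrite -[RHS]E; apply: eq_bigr => j _; rewrite !mxE.
Qed.

(** Equality case of Cauchy-Schwarz: [v] minus its projection on [u] has length zero. *)
Lemma gram_dependent u v : u != 0 -> dot u u * dot v v = dot u v ^+ 2 ->
  v = (dot v u / dot u u) *: u.
Proof.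
move=> u0 E; apply/eqP; rewrite -subr_eq0 -dot_eq0 !dotE (dotC u v).
have U0 : dot u u != 0 by rewrite dot_eq0.
move: E; rewrite (dotC u v); set a := dot u u; set b := dot v u; set c := dot v v => E.
apply/eqP; have -> : c = b ^+ 2 / a by rewrite -E mulrAC mulfV ?mul1r.
by field.
Qed.

End Dot.

Section Pointwise.
Context {R : realType}.

Lemma parseval4 (e1 e2 e3 e4 u v : 'rV[R]_4) :
  e1 != 0 -> e2 != 0 -> e3 != 0 -> e4 != 0 ->
  dot e1 e2 = 0 -> dot e1 e3 = 0 -> dot e1 e4 = 0 ->
  dot e2 e3 = 0 -> dot e2 e4 = 0 -> dot e3 e4 = 0 ->
  dot u v = dot u e1 * dot v e1 / dot e1 e1 + dot u e2 * dot v e2 / dot e2 e2 +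
    dot u e3 * dot v e3 / dot e3 e3 + dot u e4 * dot v e4 / dot e4 e4.
Proof.
move=> n1 n2 n3 n4 h12 h13 h14 h23 h24 h34.
pose b (i : 'I_4) := nth 0 [:: e1; e2; e3; e4] i.
rewrite (@parseval _ _ b).
- by rewrite !big_ord_recl big_ord0 /b /= addr0 !addrA.
- by case=> [[|[|[|[|//]]]]].
- have [h21 h31 h41 h32] : [/\ dot e2 e1 = 0, dot e3 e1 = 0, dot e4 e1 = 0 & dot e3 e2 = 0].
    by split; rewrite dotC.
  have [h42 h43] : dot e4 e2 = 0 /\ dot e4 e3 = 0 by split; rewrite dotC.
  by case=> [[|[|[|[|//]]]] ?]; case=> [[|[|[|[|//]]]] ?].
Qed.
End Pointwise.

(** * Scalar computations behind the two key steps *)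

Section Arith.
Context {R : realType}.
Implicit Types (k A : R).

(** In an orthonormal basis the first three equations read k^2 Id = S^2 + p p^T, with S the
    symmetric matrix of the tangential part of dN and p its remaining normal component. Hence k^2 Id
    - S^2 is nonnegative of rank at most one, and k or - k is an eigenvalue of S. If it were k, the
    trace would force the other eigenvalue to be - 2 A - k, whose square exceeds k^2. So det (k Id +
    S) = 0. *)
Lemma shape_arith k A a c s11 s12 s22 p1 p2 U : 0 < k -> 0 < A -> 0 < a -> 0 < c -> 0 < U ->
  k ^+ 2 * a = s11 * s11 / a + s12 * s12 / c + p1 * p1 / U ->
  0 = s11 * s12 / a + s12 * s22 / c + p1 * p2 / U ->
  k ^+ 2 * c = s12 * s12 / a + s22 * s22 / c + p2 * p2 / U ->
  c * s11 + a * s22 = - (2 * A * a * c) ->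
  (k * a + s11) * (k * c + s22) = s12 ^+ 2.
Proof.
move=> k0 A0 a0 c0 U0 e1 e2 e3 tr.
have an0 : a != 0 by rewrite gt_eqF.
have cn0 : c != 0 by rewrite gt_eqF.
have Un0 : U != 0 by rewrite gt_eqF.
pose S := s11 / a; pose T := s22 / c; pose Q := s12 ^+ 2 / (a * c).
have h1 : p1 * p1 / U = a * (k ^+ 2 - S ^+ 2 - Q).
  have -> : p1 * p1 / U = k ^+ 2 * a - s11 * s11 / a - s12 * s12 / c by rewrite e1; ring.
  by rewrite /S /Q; field; rewrite an0 cn0.
have h3 : p2 * p2 / U = c * (k ^+ 2 - T ^+ 2 - Q).
  have -> : p2 * p2 / U = k ^+ 2 * c - s12 * s12 / a - s22 * s22 / c by rewrite e3; ring.
  by rewrite /T /Q; field; rewrite an0 cn0.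
have ST : S + T = - (2 * A).
  have -> : S + T = (c * s11 + a * s22) / (a * c) by rewrite /S /T; field; rewrite an0 cn0.
  by rewrite tr; field; rewrite an0 cn0.
have h2 : p1 * p2 / U = 2 * A * s12.
  have -> : p1 * p2 / U = - (s11 * s12 / a + s12 * s22 / c) by rewrite -[LHS]subr0 {1}e2; ring.
  have -> : s11 * s12 / a + s12 * s22 / c = (S + T) * s12 by rewrite /S /T; field; rewrite an0 cn0.
  by rewrite ST; ring.
(* The determinant of the rank-one matrix p p^T vanishes. *)
have pr : (k ^+ 2 - S ^+ 2 - Q) * (k ^+ 2 - T ^+ 2 - Q) = (2 * A) ^+ 2 * Q.
  have : (p1 * p1 / U) * (p2 * p2 / U) = (p1 * p2 / U) ^+ 2 by ring.
  rewrite h1 h2 h3 => E.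
  have ac0 : a * c != 0 by rewrite mulf_neq0.
  apply: (mulfI ac0).
  transitivity (a * (k ^+ 2 - S ^+ 2 - Q) * (c * (k ^+ 2 - T ^+ 2 - Q))); first by ring.
  by rewrite E /Q; field; rewrite an0 cn0.
have n1 : 0 <= k ^+ 2 - S ^+ 2 - Q.
  by rewrite -(pmulr_rge0 _ a0) -h1 divr_ge0 ?(ltW U0) // -expr2 sqr_ge0.
have n3 : 0 <= k ^+ 2 - T ^+ 2 - Q.
  by rewrite -(pmulr_rge0 _ c0) -h3 divr_ge0 ?(ltW U0) // -expr2 sqr_ge0.
have TE : T = - (2 * A) - S by rewrite -ST; ring.
have : ((k + S) * (k + T) - Q) * ((k - S) * (k - T) - Q) = 0.
  transitivity ((k ^+ 2 - S ^+ 2 - Q) * (k ^+ 2 - T ^+ 2 - Q) - (S + T) ^+ 2 * Q); first by ring.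
  by rewrite pr ST; ring.
move=> /eqP; rewrite mulf_eq0 => /orP[/eqP P0|/eqP Q0].
  have QE : Q = (k + S) * (k + T) by lra.
  have -> : s12 ^+ 2 = a * c * Q by rewrite /Q; field; rewrite an0 cn0.
  by rewrite QE /S /T; field; rewrite an0 cn0.
(* The remaining factor is det (k Id - S); its vanishing would make the trace of p p^T equal to - 4
   A (A + k). *)
exfalso.
have QE : Q = (k - S) * (k - T) by lra.
have : 0 <= (k ^+ 2 - S ^+ 2 - Q) + (k ^+ 2 - T ^+ 2 - Q) by exact: addr_ge0.
have -> : (k ^+ 2 - S ^+ 2 - Q) + (k ^+ 2 - T ^+ 2 - Q) = - (4 * A * (A + k)).
  by rewrite QE TE; ring.
rewrite oppr_ge0 leNgt => /negP; apply.
by rewrite !mulr_gt0 // addr_gt0.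
Qed.

(** The last equation expands [<q, w1>] in the frame [X1], [X2], [N], [nu], with [P = <w1, X1>],
    [Q = <q, X1>], [T = <E X1, nu>], [m = |v|^2] and [c = |X2|^2]. Once [P] and [Q] are expressed
    through [T], all terms in [e] cancel because [2 * A + del = 2 * k]; the two surviving terms have
    the same sign and one of them is nonzero. *)
Lemma final_arith k A del m c e Q P T : 0 < k -> 0 < A -> 0 < del -> 0 < m -> 0 < c ->
  del = 2 * (k - A) -> P = e / (4 * k) - T -> T * c = Q * m / (2 * k) ->
  0 = Q * P / (m / (2 * k * del)) + (k * c) * (- (m / 2)) / A
    + (- (del * Q)) * (e / 2 - del * P) / (m * A / k) -> False.
Proof.
move=> k0 A0 d0 m0 c0 de PE TE.
have kn0 : k != 0 by rewrite gt_eqF.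
have An0 : A != 0 by rewrite gt_eqF.
have dn0 : del != 0 by rewrite gt_eqF.
have mn0 : m != 0 by rewrite gt_eqF.
have QE : Q = T * c * (2 * k) / m by rewrite TE; field; rewrite mn0 kn0.
have -> : Q * P / (m / (2 * k * del)) + (k * c) * (- (m / 2)) / A
    + (- (del * Q)) * (e / 2 - del * P) / (m * A / k) =
   - (c * k * (m / 2 + 4 * k ^+ 2 * del * (T ^+ 2 / m ^+ 2))) / A.
  rewrite QE PE de.
  field; rewrite mn0 An0 kn0 /=.
  move: dn0; rewrite de mulf_eq0 negb_or => /andP[_ ->].
  by rewrite ?andbT.
move=> /esym /eqP; rewrite mulf_eq0 invr_eq0 (negbTE An0) orbF oppr_eq0 gt_eqF //.
rewrite mulr_gt0 ?mulr_gt0 // ltr_pwDl ?divr_gt0 //.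
by rewrite mulr_ge0 ?divr_ge0 ?sqr_ge0 // mulr_ge0 ?(ltW d0) // mulr_ge0 ?sqr_ge0.
Qed.

End Arith.

(** * The Gram matrix of dy at a point *)

Section Pointwise2.
Context {R : realType}.

(** The Gram matrix of [y1], [y2] is 2 k (k g + b) with b_ij = <N_i, x_j>. Passing from [x1], [x2]
    to the orthogonal pair [x1], [X] is a unimodular change, so its determinant can be taken there,
    where [shape_arith] applies. *)
Lemma gram_degenerate (k A : R) (x1 x2 N N1 N2 : 'rV[R]_4) : 0 < k -> 0 < A ->
  dot x1 N = 0 -> dot x2 N = 0 -> dot N N = A -> dot N1 N = 0 -> dot N2 N = 0 ->
  dot N1 N1 = k ^+ 2 * dot x1 x1 -> dot N1 N2 = k ^+ 2 * dot x1 x2 ->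
  dot N2 N2 = k ^+ 2 * dot x2 x2 -> dot N1 x2 = dot N2 x1 ->
  0 < dot x1 x1 -> 0 < dot x1 x1 * dot x2 x2 - dot x1 x2 ^+ 2 ->
  dot x2 x2 * dot N1 x1 - 2 * dot x1 x2 * dot N1 x2 + dot x1 x1 * dot N2 x2 =
    - (2 * A * (dot x1 x1 * dot x2 x2 - dot x1 x2 ^+ 2)) ->
  let y1 := N1 + k *: x1 in let y2 := N2 + k *: x2 in
  dot y1 y1 * dot y2 y2 = dot y1 y2 ^+ 2.
Proof.
move=> k0 A0 x1N x2N NN N1N N2N n11 n12 n22 b12 g11 D0 tr y1 y2.
pose t := dot x1 x2 / dot x1 x1.
(* [M] is the derivative of [N] in the direction whose image is [X]. *)
pose X := x2 - t *: x1; pose M := N2 - t *: N1.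
have g11n : dot x1 x1 != 0 by rewrite gt_eqF.
have g12 : dot x1 x2 = t * dot x1 x1 by rewrite /t divfK.
have x1X : dot x1 X = 0 by rewrite /X !dotE g12; ring.
have XN : dot X N = 0 by rewrite /X !dotE x1N x2N; ring.
have MN : dot M N = 0 by rewrite /M !dotE N1N N2N; ring.
have XX : dot X X = dot x2 x2 - t ^+ 2 * dot x1 x1.
  by rewrite /X !dotE (dotC x2 x1) g12; ring.
have X0 : 0 < dot X X.
  rewrite -(pmulr_rgt0 _ g11); apply: lt_le_trans D0 _.
  by rewrite XX g12 le_eqVlt; apply/orP; left; apply/eqP; ring.
(* [u] completes an orthogonal frame of E^4. The derivatives of [N] have no [N] component, so
   outside the tangent plane they only have a [u] component. *)
have [u u0 uP] := @exists_orthogonal R 4 3 (\matrix_i nth 0 [:: x1; X; N] i) isT.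
have ux1 : dot u x1 = 0 by have := uP 0; rewrite rowK.
have uX : dot u X = 0 by have := uP 1; rewrite rowK.
have uN : dot u N = 0 by have := uP (inord 2); rewrite rowK inordK.
have x1n : x1 != 0 by rewrite -dot_gt0.
have Xn : X != 0 by rewrite -dot_gt0.
have Nn : N != 0 by rewrite -dot_gt0 NN.
have P a b := @parseval4 R x1 X N u a b x1n Xn Nn u0 x1X x1N (etrans (dotC _ _) ux1)
   XN (etrans (dotC _ _) uX) (etrans (dotC _ _) uN).
have MX1 : dot M x1 = dot N1 X by rewrite /M /X !dotE b12; ring.
have P11 := P N1 N1; have P12 := P N1 M; have P22 := P M M.
rewrite N1N !mul0r addr0 n11 in P11.
rewrite N1N !mul0r addr0 MX1 in P12.
rewrite MN !mul0r addr0 MX1 in P22.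
have N1M : dot N1 M = 0 by rewrite /M !dotE n11 n12 g12; ring.
have MM : dot M M = k ^+ 2 * dot X X.
  by rewrite XX /M !dotE (dotC N2 N1) n11 n12 n22 g12; ring.
rewrite N1M in P12; rewrite MM in P22.
have U0 : 0 < dot u u by rewrite dot_gt0.
have MX : dot M X = dot N2 x2 - 2 * t * dot N1 x2 + t ^+ 2 * dot N1 x1.
  by rewrite /M /X !dotE b12; ring.
have N1X : dot N1 X = dot N1 x2 - t * dot N1 x1 by rewrite /X !dotE.
have x2E : dot x2 x2 = dot X X + t ^+ 2 * dot x1 x1 by rewrite XX; ring.
have TR : dot X X * dot N1 x1 + dot x1 x1 * dot M X = - (2 * A * dot x1 x1 * dot X X).
  rewrite MX XX; move: tr; rewrite g12 => tr.
  transitivity (dot x2 x2 * dot N1 x1 - 2 * (t * dot x1 x1) * dot N1 x2 + dot x1 x1 * dot N2 x2); first by ring.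
  by rewrite tr; ring.
have := shape_arith k0 A0 g11 X0 U0 P11 P12 P22 TR.
move=> E.
have Y11 : dot y1 y1 = 2 * k * (k * dot x1 x1 + dot N1 x1).
  by rewrite /y1 !dotE (dotC x1 N1) n11; ring.
have Y12 : dot y1 y2 = 2 * k * (k * dot x1 x2 + dot N1 x2).
  by rewrite /y1 /y2 !dotE (dotC x1 N2) n12 -b12; ring.
have Y22 : dot y2 y2 = 2 * k * (k * dot x2 x2 + dot N2 x2).
  by rewrite /y2 !dotE (dotC x2 N2) n22; ring.
have N1x2 : dot N1 x2 = dot N1 X + t * dot N1 x1 by rewrite N1X; ring.
have N2x2 : dot N2 x2 = dot M X + 2 * t * dot N1 X + t ^+ 2 * dot N1 x1.
  by rewrite MX N1X; ring.
rewrite Y11 Y12 Y22 x2E g12 N1x2 N2x2.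
apply/eqP; rewrite -subr_eq0; apply/eqP.
transitivity (4 * k ^+ 2 * ((k * dot x1 x1 + dot N1 x1) * (k * dot X X + dot M X) - dot N1 X ^+ 2)); first by ring.
by rewrite E; ring.
Qed.

Lemma gram_trace (k A : R) (x1 x2 N1 N2 : 'rV[R]_4) :
  dot N1 N1 = k ^+ 2 * dot x1 x1 -> dot N1 N2 = k ^+ 2 * dot x1 x2 ->
  dot N2 N2 = k ^+ 2 * dot x2 x2 -> dot N1 x2 = dot N2 x1 ->
  dot x2 x2 * dot N1 x1 - 2 * dot x1 x2 * dot N1 x2 + dot x1 x1 * dot N2 x2 =
    - (2 * A * (dot x1 x1 * dot x2 x2 - dot x1 x2 ^+ 2)) ->
  let y1 := N1 + k *: x1 in let y2 := N2 + k *: x2 in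
  dot x2 x2 * dot y1 y1 - 2 * dot x1 x2 * dot y1 y2 + dot x1 x1 * dot y2 y2 =
    4 * k * (k - A) * (dot x1 x1 * dot x2 x2 - dot x1 x2 ^+ 2).
Proof.
move=> n11 n12 n22 b12 tr y1 y2.
rewrite /y1 /y2 !dotE (dotC x1 N1) (dotC x1 N2) (dotC x2 N2) n11 n12 n22 -b12.
transitivity (4 * k ^+ 2 * (dot x1 x1 * dot x2 x2 - dot x1 x2 ^+ 2) + 2 * k * (dot x2 x2 * dot N1 x1 - 2 * dot x1 x2 * dot N1 x2 + dot x1 x1 * dot N2 x2)); first by ring.
by rewrite tr; ring.
Qed.
End Pointwise2.

(** * Constancy of y = N + k x *)

(* Unification would otherwise unfold [partial] down to a limit in a filter
   whenever it compares two different derivatives. *)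
HB.lock Definition pd (R : realType) (m : nat) (V : normedModType R) (i : 'I_m)
  (f : 'rV[R]_m -> V) : 'rV[R]_m -> V := partial i f.

Section LockedPartial.
Context {R : realType} {m : nat}.
Implicit Types (W : set 'rV[R]_m) (i j : 'I_m) (z : 'rV[R]_m).

Lemma pdE (V : normedModType R) i (f : 'rV[R]_m -> V) : pd i f = partial i f.
Proof. by rewrite pd.unlock. Qed.

Lemma pd_cst (V : normedModType R) i (c : V) z : pd i (fun=> c) z = 0.
Proof. by rewrite pdE; exact: partial_cst. Qed.

Lemma pd_ext (V : normedModType R) i W (f g : 'rV[R]_m -> V) z : open W -> W z ->
  (forall w, W w -> f w = g w) -> pd i f z = pd i g z.
Proof. by rewrite !pdE; exact: partial_ext. Qed.

Lemma pdD (V : normedModType R) i (f g : 'rV[R]_m -> V) z :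
  differentiable f z -> differentiable g z ->
  pd i (fun w => f w + g w) z = pd i f z + pd i g z.
Proof. by rewrite !pdE; exact: partialD. Qed.

Lemma pdZ (V : normedModType R) i (c : R) (f : 'rV[R]_m -> V) z :
  differentiable f z -> pd i (fun w => c *: f w) z = c *: pd i f z.
Proof. by rewrite !pdE; exact: partialZ. Qed.

Lemma pd_scale n i (c : 'rV[R]_m -> R) (f : 'rV[R]_m -> 'rV[R]_n) z :
  differentiable c z -> differentiable f z ->
  pd i (fun w => c w *: f w) z = pd i c z *: f z + c z *: pd i f z.
Proof. by rewrite !pdE; exact: partial_scale. Qed.

Lemma smooth_pd (V : normedModType R) W i (f : 'rV[R]_m -> V) :
  smooth_on W f -> smooth_on W (pd i f).
Proof. by rewrite pdE; exact: smooth_partial. Qed.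

Lemma pd_comm n W (f : 'rV[R]_m -> 'rV[R]_n) i j z :
  open W -> smooth_on W f -> W z -> pd i (pd j f) z = pd j (pd i f) z.
Proof. by rewrite !pdE; exact: partial_comm. Qed.

Lemma dot_deriv n W (f g : 'rV[R]_m -> 'rV[R]_n) h i z :
  open W -> smooth_on W f -> smooth_on W g ->
  (forall w, W w -> dot (f w) (g w) = h w) -> W z ->
  dot (pd i f z) (g z) + dot (f z) (pd i g z) = pd i h z.
Proof.
rewrite !pdE => oW sf sg E Wz; rewrite -(partial_ext i oW Wz E).
by rewrite partial_dot; [|exact: smooth_diff Wz|exact: smooth_diff Wz].
Qed.
End LockedPartial.

Lemma open_nonzero (R : realType) (m : nat) (U : set 'rV[R]_m) (f : 'rV[R]_m -> R) :
  open U -> smooth_on U f -> open (U `&` [set z | f z != 0]).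
Proof.
move=> oU sf; rewrite openE => z [Uz fz]; rewrite /interior.
apply: filterI; first by have := open_nbhs_nbhs (conj oU Uz).
have cf : {for z, continuous f} by apply: differentiable_continuous; exact: smooth_diff Uz.
have : open [set y : R | y != 0] by exact: open_neq.
rewrite openE => /(_ _ fz); rewrite /interior => H.
exact: cf _ H.
Qed.

Section Envelope.
Context {R : realType} {U : set 'rV[R]_2} {x N : 'rV[R]_2 -> 'rV[R]_4} {k A : R}.
Hypotheses (oU : open U) (sx : smooth_on U x) (sN : smooth_on U N).
Hypotheses (k0 : 0 < k) (A0 : 0 < A).
Local Notation g i j z := (dot (pd i x z) (pd j x z)).
Local Notation "''d_' i f" := (pd i f) (at level 10, i at level 0, f at level 9).
Hypothesis xN : forall i z, U z -> dot ('d_i x z) (N z) = 0.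
Hypothesis NN : forall z, U z -> dot (N z) (N z) = A.
Hypothesis dNdN : forall i j z, U z -> dot ('d_i N z) ('d_j N z) = k ^+ 2 * g i j z.
Hypothesis g_gt0 : forall i z, U z -> 0 < g i i z.
Hypothesis detg_gt0 : forall i j z, i != j -> U z -> 0 < g i i z * g j j z - g i j z ^+ 2.
(** trace h = 2 N, paired with a normal vector [u] and cleared of the denominator det g. Flat second
    derivatives can stand for h since [u] does not see tangential terms. *)
Hypothesis trh : forall i j z, i != j -> U z -> forall u, (forall l, dot ('d_l x z) u = 0) ->
  g j j z * dot ('d_i ('d_i x) z) u - 2 * g i j z * dot ('d_i ('d_j x) z) u
  + g i i z * dot ('d_j ('d_j x) z) u = 2 * (g i i z * g j j z - g i j z ^+ 2) * dot (N z) u.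

Local Notation y := (fun z => N z + k *: x z).

Let sd i : smooth_on U ('d_i x). Proof. exact: smooth_pd. Qed.
Let sy : smooth_on U y.
Proof. by apply: smoothD => //; apply: smooth_scale => //; exact: smooth_cst. Qed.

Lemma dN_N i z : U z -> dot ('d_i N z) (N z) = 0.
Proof.
move=> Uz; have := dot_deriv i oU sN sN NN Uz.
by rewrite pd_cst (dotC (N z)); lra.
Qed.

Lemma dN_dx i j z : U z -> dot ('d_i N z) ('d_j x z) = - dot (N z) ('d_i ('d_j x) z).
Proof.
move=> Uz; have := dot_deriv i oU (sd j) sN (xN j) Uz.
by rewrite pd_cst (dotC _ (N z)) (dotC ('d_j x z)); lra.
Qed.

Lemma dN_dxC i j z : U z -> dot ('d_i N z) ('d_j x z) = dot ('d_j N z) ('d_i x z).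
Proof. by move=> Uz; rewrite !dN_dx // (pd_comm i j oU sx Uz). Qed.

Lemma trace_dN i j z : i != j -> U z ->
  g j j z * dot ('d_i N z) ('d_i x z) - 2 * g i j z * dot ('d_i N z) ('d_j x z) +
  g i i z * dot ('d_j N z) ('d_j x z) = - (2 * A * (g i i z * g j j z - g i j z ^+ 2)).
Proof.
move=> ij Uz; rewrite !dN_dx // !(dotC (N z)).
have := trh ij Uz (fun l => xN l Uz); rewrite NN // => E.
transitivity (- (2 * (g i i z * g j j z - g i j z ^+ 2) * A)); last by ring.
by rewrite -E; ring.
Qed.

Lemma partial_y i z : U z -> 'd_i y z = 'd_i N z + k *: 'd_i x z.
Proof.
move=> Uz; have dx := smooth_diff sx Uz; have dN := smooth_diff sN Uz.
rewrite pdD // ?pdZ //.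
by apply: differentiable_scale => //; exact: differentiable_cst.
Qed.

Lemma dy_N i z : U z -> dot ('d_i y z) (N z) = 0.
Proof. by move=> Uz; rewrite partial_y // !dotE dN_N // xN // mulr0 addr0. Qed.

(** The symmetry of <N_i, x_j> lets the cross terms add up. Products among derivatives of y thereby
    become products with tangent vectors of the surface, which gives [v_X2] and [v_xa]. *)
Lemma dy_dy i j z : U z -> dot ('d_i y z) ('d_j y z) = 2 * k * dot ('d_i y z) ('d_j x z).
Proof.
move=> Uz; rewrite !partial_y // !dotE dNdN // (dotC ('d_i x z) ('d_j N z)) (dN_dxC j i) //.
by ring.
Qed.

Lemma dy_degenerate i j z : i != j -> U z ->
  dot ('d_i y z) ('d_i y z) * dot ('d_j y z) ('d_j y z) = dot ('d_i y z) ('d_j y z) ^+ 2.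
Proof.
move=> ij Uz; rewrite !partial_y //.
apply: (@gram_degenerate _ k A _ _ (N z)) => //; rewrite ?dNdN ?xN ?NN ?dN_N ?trace_dN //.
- exact: dN_dxC.
- exact: g_gt0.
- exact: detg_gt0.
Qed.

Lemma dy_trace i j z : i != j -> U z ->
  g j j z * dot ('d_i y z) ('d_i y z) - 2 * g i j z * dot ('d_i y z) ('d_j y z)
  + g i i z * dot ('d_j y z) ('d_j y z) = 4 * k * (k - A) * (g i i z * g j j z - g i j z ^+ 2).
Proof.
move=> ij Uz; rewrite !partial_y //.
by apply: gram_trace; rewrite ?dNdN ?trace_dN //; exact: dN_dxC.
Qed.

(** * Calculus along D where y_a does not vanish *)

Section Contradiction.
Context {a b : 'I_2}.
Hypothesis ab : a != b.
Let v := 'd_a y.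
Let m z := dot (v z) (v z).
Let W := U `&` [set z | m z != 0].
Let t z := dot ('d_b y z) (v z) / m z.
Let D (f : 'rV[R]_2 -> 'rV[R]_4) z := 'd_b f z - t z *: 'd_a f z.
Let X2 := D x.
Let w := 'd_a v.
Let tau := 'd_a t.

Let sv : smooth_on U v. Proof. exact: smooth_pd. Qed.
Let sm : smooth_on U m. Proof. exact: smooth_dot. Qed.
Let oW : open W. Proof. exact: open_nonzero. Qed.
Let WU z : W z -> U z. Proof. by case. Qed.
Let sW f : smooth_on U f -> smooth_on W (f : _ -> 'rV[R]_4). Proof. exact: smooth_sub. Qed.
Let m_gt0 z : W z -> 0 < m z.
Proof. by move=> [_ mz]; rewrite lt_neqAle eq_sym mz dot_ge0. Qed.
Let st : smooth_on W t.
Proof.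
apply: smoothM => //; last by apply: smoothV => // [z []|] //; exact: smooth_sub sm.
by apply: smooth_dot => //; apply: sW => //; exact: smooth_pd.
Qed.
Let sB (f h : 'rV[R]_2 -> 'rV[R]_4) : smooth_on W f -> smooth_on W h -> smooth_on W (fun z => f z - h z).
Proof. by move=> sf sh; apply: smoothD => //; exact: smoothN. Qed.
Let sD f : smooth_on W f -> smooth_on W (D f).
Proof.
by move=> sf; apply: sB; [|apply: smooth_scale => //]; exact: smooth_pd.
Qed.
Let sX2 : smooth_on W X2. Proof. by apply: sD; exact: sW. Qed.
Let sw : smooth_on U w. Proof. exact: smooth_pd. Qed.

Let dybE z : W z -> 'd_b y z = t z *: v z.
Proof.
move=> Wz; apply: gram_dependent; last by apply: dy_degenerate => //; exact: WU.
by rewrite -dot_gt0; exact: m_gt0.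
Qed.

(** [D] kills y, so the commutator of ['d_a] and [D] applied to y leaves only [tau *: v]. *)
Let Dv z : W z -> D v z = tau z *: v z.
Proof.
move=> Wz; have Uz := WU Wz.
have dt := smooth_diff st Wz; have dv := smooth_diff sv Uz.
rewrite /D (pd_comm b a oU sy Uz) (pd_ext a oW Wz dybE) pd_scale //.
by rewrite addrK.
Qed.

Let DN z : W z -> D N z = - (k *: X2 z).
Proof.
move=> Wz; have Uz := WU Wz; have := dybE Wz.
rewrite /v !partial_y // => /eqP; rewrite -subr_eq0 => /eqP E.
apply/eqP; rewrite -subr_eq0 opprK -[X in _ == X]E; apply/eqP.
rewrite /X2 /D; apply/rowP => j; rewrite !mxE; ring.
Qed.

(** The same commutator applied to [v]: one [tau *: w] comes from it, the other from differentiating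
    [tau *: v]. *)
Let Dw z : W z -> D w z = 'd_a tau z *: v z + (2 * tau z) *: w z.
Proof.
move=> Wz; have Uz := WU Wz.
have stau : smooth_on W tau by exact: smooth_pd.
have E : forall z', W z' -> 'd_b v z' = tau z' *: v z' + t z' *: w z'.
  by move=> z' Wz'; rewrite -Dv // /D subrK.
rewrite /D (pd_comm b a oU sv Uz) (pd_ext a oW Wz E).
have dt := smooth_diff st Wz; have dtau := smooth_diff stau Wz.
have dv := smooth_diff sv Uz; have dw := smooth_diff sw Uz.
rewrite pdD ?pd_scale //; try exact: differentiable_scale.
rewrite -/tau -/w; apply/rowP => j; rewrite !mxE; ring.
Qed.

Let v_N z : W z -> dot (v z) (N z) = 0. Proof. by move=> Wz; apply: dy_N; exact: WU. Qed.

Let v_X2 z : W z -> dot (v z) (X2 z) = 0.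
Proof.
move=> Wz; have Uz := WU Wz.
have k2 : 2 * k != 0 by rewrite mulf_neq0 ?gt_eqF.
apply: (mulfI k2); rewrite mulr0 /X2 /D !dotE.
transitivity (dot (v z) ('d_b y z) - t z * dot (v z) ('d_a y z)).
  by rewrite !dy_dy //; ring.
by rewrite dybE // dotZr subrr.
Qed.

Let v_xa z : W z -> dot (v z) ('d_a x z) = m z / (2 * k).
Proof.
move=> Wz; have Uz := WU Wz; rewrite /m dy_dy //.
by field; rewrite gt_eqF.
Qed.

Let D_dot f h s z : smooth_on W f -> smooth_on W h ->
  (forall z', W z' -> dot (f z') (h z') = s z') -> W z ->
  dot (D f z) (h z) + dot (f z) (D h z) = 'd_b s z - t z * 'd_a s z.
Proof.
move=> sf sh E Wz; rewrite -(dot_deriv b oW sf sh E Wz) -(dot_deriv a oW sf sh E Wz) /D !dotE.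
by ring.
Qed.

Let q := D X2.

Let v_q z : W z -> dot (v z) (q z) = 0.
Proof.
move=> Wz; have := D_dot (sW sv) sX2 v_X2 Wz.
by rewrite !pd_cst Dv // dotZl v_X2 // mulr0 add0r mulr0 subrr.
Qed.

Let X2_N z : W z -> dot (X2 z) (N z) = 0.
Proof. by move=> Wz; have Uz := WU Wz; rewrite /X2 /D !dotE !xN //; ring. Qed.

Let q_N z : W z -> dot (q z) (N z) = k * dot (X2 z) (X2 z).
Proof.
move=> Wz; have := D_dot sX2 (sW sN) X2_N Wz.
by rewrite !pd_cst DN // !dotE -/q; lra.
Qed.

(** Derivative of [v_N] along ['d_a]: with N_a = v - k x_a, the product of [v] with N_a is
    [m - m / 2]. *)
Let w_N z : W z -> dot (w z) (N z) = - 2^-1 * m z.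
Proof.
move=> Wz; have := dot_deriv a oW (sW sv) (sW sN) v_N Wz.
have Uz := WU Wz.
have -> : 'd_a N z = v z - k *: 'd_a x z by rewrite /v partial_y // addrK.
rewrite pd_cst !dotE v_xa // -/(m z) -/w.
have -> : k * (m z / (2 * k)) = m z / 2 by field; rewrite gt_eqF.
by lra.
Qed.

Let Dm z : W z -> 'd_b m z - t z * 'd_a m z = 2 * tau z * m z.
Proof.
move=> Wz; rewrite -(D_dot (sW sv) (sW sv) (fun _ _ => erefl) Wz) Dv // !dotE /m; ring.
Qed.

(** Derivative of [w_N] along [D]. By [Dw] and [Dm] both sides contain [- (tau * m)], so only [k]
    times the product in question remains. *)
Let w_X2 z : W z -> dot (w z) (X2 z) = 0.
Proof.
move=> Wz; have := D_dot (sW sw) (sW sN) w_N Wz.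
have dm : differentiable m z by apply: smooth_diff sm _; exact: WU.
have E i : 'd_i (fun z' => - 2^-1 * m z') z = - 2^-1 * 'd_i m z.
  by rewrite -[RHS](pdZ i (- 2^-1) dm).
rewrite !E Dw // DN // !dotE v_N // w_N //.
have -> : - 2^-1 * 'd_b m z - t z * (- 2^-1 * 'd_a m z) = - (tau z * m z).
  have := Dm Wz; lra.
have kn : k != 0 by rewrite gt_eqF.
by move=> H; apply: (mulfI kn); rewrite mulr0; lra.
Qed.

Let w_q z : W z -> dot (w z) (q z) = 0.
Proof.
move=> Wz; have := D_dot (sW sw) sX2 w_X2 Wz.
by rewrite !pd_cst Dw // dotDl !dotZl v_X2 // w_X2 // -/q; lra.
Qed.

Let c z := dot (X2 z) (X2 z).
(** The constant of [dy_trace] is [2 * k * del]; [del] will also be the coefficient of [v] along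
    [X1]. *)
Let del := 2 * (k - A).

Let cE z : c z = g b b z - 2 * t z * g a b z + t z ^+ 2 * g a a z.
Proof. by rewrite /c /X2 /D !dotE (dotC ('d_b x z) ('d_a x z)); ring. Qed.

Let xa_X2 z : dot ('d_a x z) (X2 z) = g a b z - t z * g a a z.
Proof. by rewrite /X2 /D !dotE. Qed.

Let c_gt0 z : W z -> 0 < c z.
Proof.
move=> Wz; rewrite -(pmulr_rgt0 _ (g_gt0 a (WU Wz))).
apply: lt_le_trans (detg_gt0 ab (WU Wz)) _.
rewrite -subr_ge0 (_ : _ - _ = (g a b z - t z * g a a z) ^+ 2) ?sqr_ge0 //.
by rewrite cE; ring.
Qed.

(** Since y_b = t v, all Gram entries in [dy_trace] are multiples of [m], and the cofactor is
    exactly [c]. *)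
Let mc z : W z -> m z * c z = 2 * k * del * (g a a z * g b b z - g a b z ^+ 2).
Proof.
move=> Wz; have := dy_trace ab (WU Wz); rewrite dybE // !dotE -/(v z) -/(m z) => E.
by rewrite /del cE; move: E; rewrite -/v; lra.
Qed.

Let r z := - dot ('d_a x z) (X2 z) / c z.
Let X1 z := 'd_a x z + r z *: X2 z.
Let E (f : 'rV[R]_2 -> 'rV[R]_4) z := 'd_a f z + r z *: D f z.

Let sr : smooth_on W r.
Proof.
apply: smoothM => //.
  under eq_fun do rewrite -dotNr.
  by apply: smooth_dot => //; [exact: sW|exact: smoothN].
by apply: smoothV => // [z Wz|]; [rewrite gt_eqF // c_gt0|exact: smooth_dot].
Qed.

Let sX1 : smooth_on W X1.
Proof. by apply: smoothD => //; [exact: sW|exact: smooth_scale]. Qed.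

Let E_dot f h s z : smooth_on W f -> smooth_on W h ->
  (forall z', W z' -> dot (f z') (h z') = s z') -> W z ->
  dot (E f z) (h z) + dot (f z) (E h z) =
  'd_a s z + r z * ('d_b s z - t z * 'd_a s z).
Proof.
move=> sf sh H Wz.
by rewrite -(D_dot sf sh H Wz) -(dot_deriv a oW sf sh H Wz) /E !dotE; ring.
Qed.

Let rc z : W z -> r z * c z = - (g a b z - t z * g a a z).
Proof. by move=> Wz; rewrite /r divfK ?xa_X2 // gt_eqF // c_gt0. Qed.

Let X1_X2 z : W z -> dot (X1 z) (X2 z) = 0.
Proof. by move=> Wz; rewrite /X1 dotDl dotZl -/(c z) rc // xa_X2 addrN. Qed.

Let v_X1 z : W z -> dot (v z) (X1 z) = (2 * k)^-1 * m z.
Proof. by move=> Wz; rewrite /X1 dotDr dotZr v_xa // v_X2 // mulr0 addr0 mulrC. Qed.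

Let del_gt0 z : W z -> 0 < del.
Proof.
move=> Wz; have : 0 < m z * c z by rewrite mulr_gt0 ?m_gt0 ?c_gt0.
have dg := detg_gt0 ab (WU Wz); have k2 : 0 < 2 * k by rewrite mulr_gt0.
by rewrite mc // (pmulr_lgt0 _ dg) (pmulr_rgt0 _ k2).
Qed.

Let X1_X1E z : W z -> dot (X1 z) (X1 z) = g a a z - r z ^+ 2 * c z.
Proof.
move=> Wz; transitivity (dot ('d_a x z) (X1 z) + r z * dot (X2 z) (X1 z)).
  by rewrite {1}/X1 dotDl dotZl.
rewrite (dotC (X2 z)) X1_X2 // mulr0 addr0 /X1 dotDr dotZr xa_X2.
by have := rc Wz; rewrite expr2 -mulrA => ->; ring.
Qed.

(** [X1], [X2] arise from x_a, x_b by a unimodular change and are orthogonal, so [c] times this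
    square is det g, which [mc] evaluates. *)
Let X1_X1 z : W z -> dot (X1 z) (X1 z) = (2 * k * del)^-1 * m z.
Proof.
move=> Wz; have c0 := c_gt0 Wz; have cn : c z != 0 by rewrite gt_eqF.
have dn : 2 * k * del != 0.
  by rewrite gt_eqF //; apply: mulr_gt0 (del_gt0 Wz); exact: mulr_gt0.
apply: (mulfI cn); rewrite mulrCA [c z * m z]mulrC mc // mulKf // X1_X1E //.
transitivity (g a a z * c z - (r z * c z) ^+ 2); first by ring.
by rewrite rc // cE; ring.
Qed.

(** [trh] in the orthogonal frame [X1], [X2], where only diagonal terms survive. Derivatives of the
    coefficients [t] and [r] only contribute multiples of tangent vectors, invisible to [u]. *)
Let hess_trace z : W z -> forall u, (forall l, dot ('d_l x z) u = 0) -> dot (N z) u = 0 ->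
  dot (E X1 z) u * c z + dot (q z) u * dot (X1 z) (X1 z) = 0.
Proof.
move=> Wz u xu Nu; have Uz := WU Wz.
have dx i := smooth_diff (sd i) Uz.
have dt := smooth_diff st Wz; have dX2 := smooth_diff sX2 Wz; have dr := smooth_diff sr Wz.
pose h i j := dot ('d_i ('d_j x) z) u.
have hba : h b a = h a b by rewrite /h (pd_comm b a oU sx Uz).
have H2 i : dot ('d_i X2 z) u = h i b - t z * h i a.
  have -> : X2 = (fun z => 'd_b x z + (- t z) *: 'd_a x z).
    by apply/funext => z'; rewrite /X2 /D scaleNr.
  have dNt : differentiable (fun z => - t z) z by exact: differentiableN.
  rewrite pdD //; last exact: differentiable_scale.
  rewrite pd_scale // 2!dotDl 2!dotZl xu mulr0 add0r -/(h i b) -/(h i a).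
  by rewrite mulNr.
have H1 i : dot ('d_i X1 z) u = h i a + r z * (h i b - t z * h i a).
  rewrite /X1 pdD //; last exact: differentiable_scale.
  rewrite pd_scale // 2!dotDl 2!dotZl H2.
  have -> : dot (X2 z) u = 0 by rewrite /X2 /D !dotE !xu; ring.
  by rewrite mulr0 add0r.
have -> : dot (E X1 z) u = h a a + r z * (h a b - t z * h a a)
    + r z * (h b a + r z * (h b b - t z * h b a) - t z * (h a a + r z * (h a b - t z * h a a))).
  by rewrite /E /D dotDl dotZl dotDl dotNl dotZl !H1.
have -> : dot (q z) u = h b b - t z * h b a - t z * (h a b - t z * h a a).
  by rewrite /q {1}/D dotDl dotNl dotZl !H2.
have T := trh ab Uz xu; rewrite Nu mulr0 -/(h a a) -/(h a b) -/(h b b) in T.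
rewrite X1_X1E // hba.
(* [T0] and [T1] restate the choice of [c] and [r]; modulo them the claim is [T]. *)
have T0 : c z - (g b b z - 2 * t z * g a b z + t z ^+ 2 * g a a z) = 0 by rewrite cE subrr.
have T1 : r z * c z + g a b z - t z * g a a z = 0 by rewrite rc //; ring.
transitivity ((g b b z * h a a - 2 * g a b z * h a b + g a a z * h b b)
  + h a a * (c z - (g b b z - 2 * t z * g a b z + t z ^+ 2 * g a a z))
  + (2 * h a b - 2 * t z * h a a) * (r z * c z + g a b z - t z * g a a z)); first by ring.
by rewrite T T0 T1 !mulr0 !addr0.
Qed.

Lemma partial_radial_eq0 z : U z -> 'd_a y z = 0.
Proof.
move=> Uz; apply/eqP; rewrite -dot_eq0; apply: contraT => mz.
have Wz : W z by split.
have m0 := m_gt0 Wz; have c0 := c_gt0 Wz; have d0 := del_gt0 Wz.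
have kn : k != 0 by rewrite gt_eqF.
have dn : del != 0 by rewrite gt_eqF.
(* [nu] is the normal part of [v z]: the latter is orthogonal to [X2 z] and has coefficient [del]
   along [X1 z]. It spans the normal direction orthogonal to [N z]. *)
pose w1 := E v z; pose nu := v z - del *: X1 z.
have w1E : w1 = w z + (r z * tau z) *: v z by rewrite /w1 /E Dv // scalerA.
have w1l u : dot w1 u = dot (w z) u + r z * tau z * dot (v z) u.
  by rewrite w1E dotDl dotZl.
have nul u : dot nu u = dot (v z) u - del * dot (X1 z) u.
  by rewrite /nu dotDl dotNl dotZl.
have nur u : dot u nu = dot (v z) u - del * dot (X1 z) u by rewrite dotC nul.
have w1N : dot w1 (N z) = - (m z / 2).
  by rewrite w1l w_N // v_N // mulr0 addr0; lra.
have w1X2 : dot w1 (X2 z) = 0 by rewrite w1l w_X2 // v_X2 // mulr0 addr0.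
have w1q : dot (q z) w1 = 0 by rewrite dotC w1l w_q // v_q // mulr0 addr0.
(* [e] is the derivative of [m] along [E]. *)
pose e := 'd_a m z + r z * ('d_b m z - t z * 'd_a m z).
have dm : differentiable m z by exact: smooth_diff sm _.
have mZ (l : R) i : 'd_i (fun z' => l * m z') z = l * 'd_i m z.
  by rewrite -[RHS](pdZ i l dm).
have w1v : dot w1 (v z) = e / 2.
  have := E_dot (sW sv) (sW sv) (fun _ _ => erefl) Wz.
  by rewrite -/(e) (dotC (v z)) -/w1; lra.
pose P := dot w1 (X1 z); pose EX := E X1 z.
(* By [v_X1] and [X1_X1] both products are constant multiples of [m], so their derivatives along [E]
   are multiples of [e]. *)
have vEX : P + dot (v z) EX = e / (2 * k).
  by rewrite (E_dot (sW sv) sX1 v_X1 Wz) !mZ /e; ring.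
have X1EX : dot (X1 z) EX = e / (4 * k * del).
  have := E_dot sX1 sX1 X1_X1 Wz.
  rewrite !mZ (dotC (X1 z)) -/EX => H.
  have -> : dot EX (X1 z) = (dot EX (X1 z) + dot EX (X1 z)) / 2 by lra.
  by rewrite H /e; field; rewrite kn dn.
pose T := dot EX nu; pose Q := dot (q z) (X1 z).
have TE : T = e / (4 * k) - P.
  rewrite /T nur X1EX.
  have -> : dot (v z) EX = e / (2 * k) - P by rewrite -vEX; ring.
  by field; rewrite kn dn.
have qnu : dot (q z) nu = - (del * Q) by rewrite nur v_q // add0r (dotC (X1 z)).
have X1N : dot (X1 z) (N z) = 0.
  by rewrite /X1 dotDl dotZl xN // X2_N // mulr0 addr0.
have Nnu : dot (N z) nu = 0 by rewrite nur X1N v_N //; ring.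
have X1nu : dot (X1 z) nu = 0.
  by rewrite nur v_X1 // X1_X1 //; field; rewrite kn dn.
have X2nu : dot (X2 z) nu = 0.
  by rewrite nur v_X2 // X1_X2 //; ring.
have xanu : dot ('d_a x z) nu = 0.
  have -> : 'd_a x z = X1 z - r z *: X2 z by rewrite /X1 addrK.
  by rewrite dotDl dotNl dotZl X1nu X2nu; ring.
have xnu i : dot ('d_i x z) nu = 0.
  have [->//|ia] := eqVneq i a.
  have -> : i = b.
    apply/val_inj; move: ia ab; case: i a b => [[|[|//]] ?] [[|[|//]] ?] [[|[|//]] ?] //.
  have -> : 'd_b x z = X2 z + t z *: 'd_a x z by rewrite /X2 /D subrK.
  by rewrite dotDl dotZl X2nu xanu; ring.
have nunu : dot nu nu = m z * A / k.
  by rewrite nul X1nu nur (dotC (X1 z)) v_X1 // -/(m z) /del; field; exact: kn.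
have w1nu : dot w1 nu = e / 2 - del * P by rewrite nur (dotC (v z)) w1v (dotC (X1 z)).
(* As [nu] is normal and orthogonal to [N z], the trace of h vanishes on it; this ties [E X1] to
   [q]. *)
have TC : T * c z = Q * m z / (2 * k).
  have := hess_trace Wz xnu Nnu; rewrite -/EX -/T qnu X1_X1 // => H.
  have -> : T * c z = del * Q * ((2 * k * del)^-1 * m z) by lra.
  by field; rewrite kn dn.
have An : A != 0 by rewrite gt_eqF.
have X1n : X1 z != 0.
  rewrite -dot_gt0 X1_X1 //; apply: mulr_gt0 => //; rewrite invr_gt0.
  by apply: mulr_gt0 => //; exact: mulr_gt0.
have X2n : X2 z != 0 by rewrite -dot_gt0.
have Nn : N z != 0 by rewrite -dot_gt0 NN.
have nun : nu != 0 by rewrite -dot_gt0 nunu divr_gt0 // mulr_gt0.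
exfalso; apply: (@final_arith _ k A del (m z) (c z) e Q P T) => //.
  by rewrite TE; ring.
(* [<q, w1>] is zero because [q] is orthogonal to both [w] and [v]; its expansion has no [X2] term
   by [w1X2]. *)
rewrite -w1q (@parseval4 _ (X1 z) (X2 z) (N z) nu) //; last 2 first.
- exact: X1_X2.
- exact: X2_N.
rewrite w1X2 mulr0 mul0r addr0 w1N q_N // NN // qnu w1nu nunu X1_X1 //.
by rewrite -/Q -/P -/(c z) [in RHS](mulrC (m z) (_^-1)).
Qed.

End Contradiction.

Lemma dy_eq0 i z : U z -> 'd_i y z = 0.
Proof.
apply: (@partial_radial_eq0 i (if i == 0 then 1 else 0)).
by case: i => [[|[|//]] ?].
Qed.
End Envelope.

(** * Local surface theory *)

(** An arbitrary ordered pair of distinct indices, so that the two coordinates can exchange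
    roles. *)
Lemma sum_ord2 (V : nmodType) (f : 'I_2 -> V) i j : i != j -> \sum_k f k = f i + f j.
Proof.
move=> ij; rewrite (bigD1 i) //= (bigD1 j) /=; last by rewrite eq_sym.
rewrite big1 ?addr0 // => k /andP[ki kj]; move: ij ki kj.
by case: i j k => [[|[|//]] ?] [[|[|//]] ?] [[|[|//]] ?].
Qed.

Lemma invmx2 (K : fieldType) (g : 'M[K]_2) i j : i != j -> g i j = g j i ->
  g i i * g j j - g i j ^+ 2 != 0 ->
  [/\ g \in unitmx, invmx g i i = g j j / (g i i * g j j - g i j ^+ 2) &
  invmx g i j = - g i j / (g i i * g j j - g i j ^+ 2)].
Proof.
move=> ij gs d0.
pose d := g i i * g j j - g i j ^+ 2.
pose B := \matrix_(k, l) ((if k == l then (if k == i then g j j else g i i) else - g k l) / d).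
have ji : (j == i) = false by rewrite eq_sym (negbTE ij).
have Bii : B i i = g j j / d by rewrite mxE !eqxx.
have Bij : B i j = - g i j / d by rewrite mxE (negbTE ij).
have Bji : B j i = - g i j / d by rewrite mxE ji gs.
have Bjj : B j j = g i i / d by rewrite mxE eqxx ji.
have E : g *m B = 1%:M.
  have Eij k l : (g *m B) k l = g k i * B i l + g k j * B j l by rewrite mxE (sum_ord2 _ ij).
  have H k : (k == i) || (k == j).
    by move: ij; case: i j k {gs d0 d B ji Bii Bij Bji Bjj Eij} => [[|[|//]] ?] [[|[|//]] ?] [[|[|//]] ?].
  apply/matrixP => k l; rewrite Eij [RHS]mxE.
  case/orP: (H k) => /eqP ->; case/orP: (H l) => /eqP ->; rewrite ?eqxx ?ji ?(negbTE ij) ?Bii ?Bij ?Bji ?Bjj /= -?gs /d; by field.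
have gu : g \in unitmx by case: (mulmx1_unit E).
have -> : invmx g = B by rewrite -[LHS]mulmx1 -E mulKmx.
by [].
Qed.

Lemma invmx_sym (K : fieldType) n (g : 'M[K]_n) : g^T = g -> (invmx g)^T = invmx g.
Proof. by move=> gs; rewrite trmx_inv gs. Qed.

(** * Metric traces and normal projection *)

Section MetricTrace.
Context {R : realType} {V : lmodType R}.
Implicit Types (g J : 'M[R]_2) (B : 'I_2 -> 'I_2 -> V).

Lemma metric_trace_ext g B B' : (forall i j, B i j = B' i j) ->
  metric_trace g B = metric_trace g B'.
Proof. by move=> E; apply: eq_bigr => i _; apply: eq_bigr => j _; rewrite E. Qed.

Lemma metric_traceD g B B' :
  metric_trace g (fun i j => B i j + B' i j) = metric_trace g B + metric_trace g B'.
Proof.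
rewrite -big_split; apply: eq_bigr => i _; rewrite -big_split; apply: eq_bigr => j _.
by rewrite /= scalerDr.
Qed.

Lemma metric_traceZ g (a : 'I_2 -> 'I_2 -> R) (v : V) :
  metric_trace g (fun i j => a i j *: v) = metric_trace g a *: v.
Proof.
rewrite scaler_suml; apply: eq_bigr => i _; rewrite scaler_suml; apply: eq_bigr => j _.
by rewrite scalerA.
Qed.

(** Invertibility of J g J^T gives that of [g] and the identity [invmx g = J^T *m invmx g' *m J];
    the rest reorders sums. *)
Lemma metric_trace_change g J B : J *m g *m J^T \in unitmx ->
  metric_trace (J *m g *m J^T) (fun i j => \sum_a \sum_b (J i a * J j b) *: B a b) =
  metric_trace g B.
Proof.
move=> gu; set g' := J *m g *m J^T.
have E : J *m (g *m J^T *m invmx g') = 1%:M by rewrite !mulmxA mulmxV.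
have E2 : g *m (J^T *m invmx g' *m J) = 1%:M by rewrite !mulmxA -[RHS](mulmx1C E).
have gu' : g \in unitmx by case: (mulmx1_unit E2).
have E3 : invmx g = J^T *m invmx g' *m J.
  by rewrite -[LHS]mulmx1 -E2 mulKmx.
rewrite /metric_trace.
under eq_bigr => i _ do under eq_bigr => j _ do rewrite scaler_sumr.
under eq_bigr => i _ do rewrite exchange_big /=.
rewrite exchange_big; apply: eq_bigr => a _ /=.
under eq_bigr => i _ do under eq_bigr => j _ do rewrite scaler_sumr.
under eq_bigr => i _ do rewrite exchange_big /=.
rewrite exchange_big; apply: eq_bigr => b _ /=.
rewrite E3 mxE scaler_suml exchange_big /=; apply: eq_bigr => j _.
rewrite mxE mulr_suml scaler_suml; apply: eq_bigr => i _.
by rewrite scalerA !mxE; congr (_ *: _); ring.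
Qed.

Lemma metric_trace2 g B i j : i != j -> g i j = g j i -> B i j = B j i ->
  g i i * g j j - g i j ^+ 2 != 0 ->
  (g i i * g j j - g i j ^+ 2) *: metric_trace g B =
  g j j *: B i i - (2 * g i j) *: B i j + g i i *: B j j.
Proof.
move=> ij gs Bs d0; have [_ E1 E2] := invmx2 ij gs d0.
have ji : j != i by rewrite eq_sym.
have d0' : g j j * g i i - g j i ^+ 2 != 0 by rewrite -gs mulrC.
have [_ E3 E4] := invmx2 ji (esym gs) d0'.
rewrite /metric_trace (sum_ord2 _ ij) !(sum_ord2 _ ij) E1 E2 E3 E4 -Bs -gs.
rewrite (mulrC (g j j) (g i i)) !scalerDr !scalerA -!addrA.
set d := (g i i * g j j - g i j ^+ 2) in d0 *.
have D u : d * (u / d) = u by rewrite mulrCA mulfV ?mulr1.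
rewrite !D !addrA -[_ + _ *: B i j + _ *: B i j]addrA -scalerDl; congr (_ + _ + _).
by rewrite -scaleNr; congr (_ *: _); ring.
Qed.
End MetricTrace.

Section NormalPart.
Context {R : realType} {n : nat} (F : 'rV[R]_2 -> 'rV[R]_n) (z : 'rV[R]_2).
Implicit Types v w : 'rV[R]_n.

Lemma induced_metricE i j : induced_metric F z i j = dot (pd i F z) (pd j F z).
Proof. by rewrite mxE !pdE. Qed.

Lemma induced_metric_sym : (induced_metric F z)^T = induced_metric F z.
Proof. by apply/matrixP => i j; rewrite mxE !induced_metricE dotC. Qed.

Lemma tangent_partE v : tangent_part F z v =
  metric_trace (induced_metric F z) (fun i j => dot v (pd i F z) *: pd j F z).
Proof.
by apply: eq_bigr => i _; apply: eq_bigr => j _; rewrite scalerA !pdE.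
Qed.

Lemma normal_partD v w : normal_part F z (v + w) = normal_part F z v + normal_part F z w.
Proof.
rewrite /normal_part addrACA -opprD; congr (_ - _).
rewrite !tangent_partE -metric_traceD; apply: metric_trace_ext => i j.
by rewrite dotDl scalerDl.
Qed.

Lemma normal_partZ (k : R) v : normal_part F z (k *: v) = k *: normal_part F z v.
Proof.
rewrite /normal_part scalerBr; congr (_ - _).
rewrite !tangent_partE scaler_sumr; apply: eq_bigr => i _; rewrite scaler_sumr.
by apply: eq_bigr => j _; rewrite dotZl !scalerA; congr (_ *: _); ring.
Qed.

Lemma normal_part_sum (I : finType) (v : I -> 'rV[R]_n) :
  normal_part F z (\sum_i v i) = \sum_i normal_part F z (v i).
Proof.
apply: (big_morph (normal_part F z)) => [v1 v2|]; first exact: normal_partD.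
by rewrite -(scale0r 0) normal_partZ !scale0r.
Qed.

Lemma normal_part_id v : (forall i, dot v (pd i F z) = 0) -> normal_part F z v = v.
Proof.
move=> v0; rewrite /normal_part tangent_partE /metric_trace big1 ?subr0 // => i _.
by rewrite big1 // => j _; rewrite v0 scale0r scaler0.
Qed.

Lemma dot_normal_part v w : (forall i, dot (pd i F z) w = 0) ->
  dot (normal_part F z v) w = dot v w.
Proof.
move=> w0; rewrite /normal_part tangent_partE dotDl dotNl /metric_trace dot_suml big1 ?subr0 // => i _.
by rewrite dot_suml big1 // => j _; rewrite !dotZl w0 !mulr0.
Qed.

Hypothesis gu : induced_metric F z \in unitmx.

Lemma dot_tangent_part v k : dot (tangent_part F z v) (pd k F z) = dot v (pd k F z).
Proof.
rewrite tangent_partE /metric_trace dot_suml.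
transitivity (\sum_i dot v (pd i F z) * (1%:M : 'M[R]_2) i k).
  apply: eq_bigr => i _; rewrite dot_suml -(mulVmx gu) mxE mulr_sumr.
  by apply: eq_bigr => j _; rewrite !dotZl induced_metricE; ring.
rewrite (bigD1 k) //= big1 ?addr0 => [|i ik]; first by rewrite mxE eqxx mulr1.
by rewrite mxE (negbTE ik) mulr0.
Qed.

Lemma normal_part_perp v k : dot (normal_part F z v) (pd k F z) = 0.
Proof. by rewrite /normal_part dotDl dotNl dot_tangent_part subrr. Qed.

Lemma normal_part_tangent k : normal_part F z (pd k F z) = 0.
Proof.
apply/eqP; rewrite -dot_eq0; apply/eqP.
rewrite {2}/normal_part tangent_partE dotDr dotNr normal_part_perp /metric_trace dot_sumr.
rewrite big1 ?subr0 // => i _; rewrite dot_sumr big1 // => j _.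
by rewrite !dotZr normal_part_perp !mulr0.
Qed.
End NormalPart.

Section LocalSurface.
Context {R : realType} {n : nat} {U : set 'rV[R]_2} {F : 'rV[R]_2 -> 'rV[R]_n}.
Hypotheses (oU : open U) (sF : smooth_on U F).
Hypothesis rf : forall z, U z -> row_free ('J F z).
Local Notation g i j z := (dot (pd i F z) (pd j F z)).
Local Notation N := (mean_curvature_local F).

Lemma pd_jacobian i z : U z -> pd i F z = delta_mx 0 i *m 'J F z.
Proof. by move=> Uz; rewrite pdE /partial deriveEjacobian //; exact: smooth_diff Uz. Qed.

Lemma metric_gt0 i z : U z -> 0 < g i i z.
Proof.
move=> Uz; rewrite dot_gt0 pd_jacobian //; apply/eqP => /eqP.
rewrite mulmx_free_eq0 ?rf // => /eqP/matrixP/(_ 0 i).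
by rewrite !mxE !eqxx => /eqP; rewrite oner_eq0.
Qed.

Lemma metric_det_gt0 i j z : i != j -> U z -> 0 < g i i z * g j j z - g i j z ^+ 2.
Proof.
move=> ij Uz; have g0 := metric_gt0 i Uz; have gn : g i i z != 0 by rewrite gt_eqF.
pose t := g i j z / g i i z; pose X := pd j F z - t *: pd i F z.
have X0 : X != 0.
  have -> : X = (delta_mx 0 j - t *: delta_mx 0 i) *m 'J F z.
    by rewrite mulmxBl -scalemxAl -!pd_jacobian.
  apply/eqP => /eqP; rewrite mulmx_free_eq0 ?rf // => /eqP/matrixP/(_ 0 j).
  rewrite !mxE !eqxx eq_sym (negbTE ij) /= mulr0 subr0 => /eqP.
  by rewrite oner_eq0.
have -> : g i i z * g j j z - g i j z ^+ 2 = g i i z * dot X X.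
  by rewrite /X !dotE (dotC (pd j F z) (pd i F z)) /t; field.
by rewrite mulr_gt0 // dot_gt0.
Qed.

Lemma induced_metric_inv i j z : i != j -> U z ->
  [/\ induced_metric F z \in unitmx,
     invmx (induced_metric F z) i i = g j j z / (g i i z * g j j z - g i j z ^+ 2) &
     invmx (induced_metric F z) i j = - g i j z / (g i i z * g j j z - g i j z ^+ 2)].
Proof.
move=> ij Uz; have := @invmx2 _ (induced_metric F z) i j ij.
by rewrite !induced_metricE dotC; apply => //; rewrite dotC gt_eqF // metric_det_gt0.
Qed.

Lemma induced_metric_unit z : U z -> induced_metric F z \in unitmx.
Proof. by move=> Uz; case: (@induced_metric_inv 0 1 z isT Uz). Qed.

Lemma smooth_metric i j : smooth_on U (fun z => g i j z).
Proof. by apply: smooth_dot => //; exact: smooth_pd. Qed.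

Lemma smooth_inv_metric i j : smooth_on U (fun z => invmx (induced_metric F z) i j).
Proof.
have sdet k l : k != l -> smooth_on U (fun z => (g k k z * g l l z - g k l z ^+ 2)^-1).
  move=> kl; apply: smoothV => // [z Uz|]; first by rewrite gt_eqF // metric_det_gt0.
  under eq_fun do rewrite expr2 -mulNr -dotNl.
  apply: smoothD => //; apply: smoothM => //; try exact: smooth_metric.
  by apply: smooth_dot => //; [apply: smoothN => //|]; exact: smooth_pd.
have [->|ij] := eqVneq i j.
  have [k jk] : exists k, j != k.
    by case: j => [[|[|//]] ?]; [exists 1|exists 0].
  apply: (@smooth_ext _ _ U oU _ (fun z => g k k z * (g j j z * g k k z - g j k z ^+ 2)^-1)).
    by move=> z Uz; case: (induced_metric_inv jk Uz).
  by apply: smoothM => //; [exact: smooth_metric|exact: sdet].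
apply: (@smooth_ext _ _ U oU _ (fun z => - g i j z * (g i i z * g j j z - g i j z ^+ 2)^-1)).
  by move=> z Uz; case: (induced_metric_inv ij Uz).
apply: smoothM => //; last exact: sdet.
under eq_fun do rewrite -dotNl.
by apply: smooth_dot => //; [apply: smoothN => //|]; exact: smooth_pd.
Qed.

Lemma smooth_second_form i j : smooth_on U (fun z => second_form F z i j).
Proof.
have s2 : smooth_on U (pd i (pd j F)) by do 2!apply: smooth_pd.
apply: (@smooth_ext _ _ U oU _ (fun z => pd i (pd j F) z + - \sum_k \sum_l
   (invmx (induced_metric F z) k l * dot (pd i (pd j F) z) (pd k F z)) *: pd l F z)).
  by move=> z Uz; rewrite !pdE; congr (_ - _); apply: eq_bigr => k _; apply: eq_bigr => l _; rewrite !pdE.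
apply: smoothD => //; apply: smoothN => //; apply: smooth_sum => // k.
apply: smooth_sum => // l; apply: smooth_scale => //; last exact: smooth_pd.
apply: smoothM => //; first exact: smooth_inv_metric.
by apply: smooth_dot => //; exact: smooth_pd.
Qed.

Lemma smooth_mean_curvature : smooth_on U N.
Proof.
apply: smooth_scale => //; first exact: smooth_cst.
apply: smooth_sum => // i; apply: smooth_sum => // j.
by apply: smooth_scale => //; [exact: smooth_inv_metric|exact: smooth_second_form].
Qed.

Lemma second_form_sym i j z : U z -> second_form F z i j = second_form F z j i.
Proof.
by move=> Uz; rewrite /second_form -!pdE (pd_comm i j oU sF Uz).
Qed.

Lemma mean_curvature_perp k z : U z -> dot (pd k F z) (N z) = 0.
Proof.
move=> Uz; rewrite dotC dotZl dot_suml big1 ?mulr0 // => i _; rewrite dot_suml big1 // => j _.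
by rewrite dotZl normal_part_perp ?mulr0 // induced_metric_unit.
Qed.

Lemma mean_curvature_trace i j z : i != j -> U z ->
  forall u, (forall l, dot (pd l F z) u = 0) ->
  g j j z * dot (pd i (pd i F) z) u - 2 * g i j z * dot (pd i (pd j F) z) u
  + g i i z * dot (pd j (pd j F) z) u =
  2 * (g i i z * g j j z - g i j z ^+ 2) * dot (N z) u.
Proof.
move=> ij Uz u u0.
have D0 := metric_det_gt0 ij Uz.
have gs : induced_metric F z i j = induced_metric F z j i by rewrite !induced_metricE dotC.
have d0 : induced_metric F z i i * induced_metric F z j j - induced_metric F z i j ^+ 2 != 0.
  by rewrite !induced_metricE gt_eqF.
have := metric_trace2 ij gs (second_form_sym i j Uz) d0.
rewrite !induced_metricE => E.
have HD k l : dot (pd k (pd l F) z) u = dot (second_form F z k l) u.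
  by rewrite /second_form -!pdE dot_normal_part.
have MT : metric_trace (induced_metric F z) (second_form F z) = 2 *: N z.
  by rewrite /mean_curvature_local scalerA mulfV ?scale1r // pnatr_eq0.
rewrite MT in E; rewrite !HD.
move: (second_form F z i i) (second_form F z i j) (second_form F z j j) (N z) E => h1 h2 h3 H E {HD MT}.
transitivity (dot ((g i i z * g j j z - g i j z ^+ 2) *: (2 *: H)) u).
  by rewrite E dotDl dotDl dotNl !dotZl.
by rewrite !dotZl; ring.
Qed.

(** Of the six products arising from the derivatives of the induced metric, four cancel and two
    coincide. *)
Lemma christoffelE k i j z : U z -> christoffel (induced_metric F) k i j z =
  \sum_l invmx (induced_metric F z) k l * dot (pd i (pd j F) z) (pd l F z).
Proof.
move=> Uz.
have dg i' j' l' : partial i' (fun w => induced_metric F w j' l') z =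
    dot (pd i' (pd j' F) z) (pd l' F z) + dot (pd j' F z) (pd i' (pd l' F) z).
  under eq_fun do rewrite induced_metricE.
  rewrite -pdE; symmetry; apply: (dot_deriv i' oU) => //; exact: smooth_pd.
rewrite /christoffel mulr_sumr; apply: eq_bigr => l _; rewrite !dg.
rewrite (pd_comm j i oU sF Uz) (pd_comm l i oU sF Uz) (pd_comm l j oU sF Uz).
rewrite (dotC (pd i F z)) (dotC (pd j F z)).
by field.
Qed.

(** Gauss formula: the Christoffel term is the tangential part of the flat second derivative. *)
Lemma hessianE i j z : U z -> hessian (induced_metric F) F z i j = second_form F z i j.
Proof.
move=> Uz; rewrite /hessian /second_form /normal_part -!pdE; congr (_ - _).
rewrite tangent_partE /metric_trace exchange_big /=; apply: eq_bigr => k _.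
rewrite christoffelE // scaler_suml; apply: eq_bigr => l _.
rewrite scalerA -!pdE; congr (_ * _ *: _).
by rewrite -{1}(invmx_sym (induced_metric_sym F z)) mxE.
Qed.

(** Beltrami's formula. *)
Lemma laplacianE z : U z -> laplacian (induced_metric F) F z = - (2 *: N z).
Proof.
move=> Uz; rewrite /laplacian (metric_trace_ext _ (B' := second_form F z)).
  by rewrite /mean_curvature_local scalerA mulfV ?scale1r // pnatr_eq0.
by move=> i j; exact: hessianE.
Qed.

Lemma pd_subc q l z : U z -> pd l (fun w => F w - q) z = pd l F z.
Proof.
move=> Uz; have dF := smooth_diff sF Uz.
by rewrite pdD ?pd_cst ?addr0.
Qed.

(** Derivative of the orthogonality of [pd j F] and [F - q]. The parameter [r] is the square of the
    radius. *)
Lemma sphere_hess q (r : R) i j z : (forall w, U w -> dot (F w - q) (F w - q) = r) -> U z ->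
  dot (pd i (pd j F) z) (F z - q) = - g i j z.
Proof.
move=> sph Uz.
have sFq : smooth_on U (fun w => F w - q) by apply: smoothD => //; exact: smooth_cst.
have perp l w : U w -> dot (pd l F w) (F w - q) = 0.
  move=> Uw; have := dot_deriv l oU sFq sFq sph Uw.
  by rewrite pd_cst pd_subc // (dotC (F w - q)); lra.
have := dot_deriv i oU (smooth_pd j sF) sFq (perp j) Uz.
by rewrite pd_cst pd_subc // (dotC (pd j F z)); lra.
Qed.

Lemma sphere_perp q (r : R) l z : (forall w, U w -> dot (F w - q) (F w - q) = r) -> U z ->
  dot (F z - q) (pd l F z) = 0.
Proof.
move=> sph Uz.
have sFq : smooth_on U (fun w => F w - q) by apply: smoothD => //; exact: smooth_cst.
have := dot_deriv l oU sFq sFq sph Uz.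
by rewrite pd_cst pd_subc // (dotC (pd l F z)); lra.
Qed.

(** Projecting to the sphere removes the radial component of the second derivatives, which is
    [- (g i j z / r)] times the normal vector [F z - q]; again [r] is the squared radius. *)
Lemma sphere_mean_curvature_localE q (r : R) z : r != 0 ->
  (forall w, U w -> dot (F w - q) (F w - q) = r) -> U z ->
  sphere_mean_curvature_local q F z = N z + r^-1 *: (F z - q).
Proof.
move=> r0 sph Uz; have gu := induced_metric_unit Uz.
pose X := F z - q.
have S i j : sphere_second_form q F z i j = second_form F z i j + (g i j z / r) *: X.
  rewrite /sphere_second_form /sphere_tangent_part -!pdE (sphere_hess i j sph Uz) sph //.
  have XN : normal_part F z X = X.
    by apply: normal_part_id => l; exact: sphere_perp sph Uz.
  rewrite -scaleNr normal_partD normal_partZ XN.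
  by rewrite /second_form -!pdE mulNr opprK.
rewrite /sphere_mean_curvature_local (metric_trace_ext _ S) metric_traceD scalerDr; congr (_ + _).
rewrite metric_traceZ scalerA; congr (_ *: _).
(* The trace of the metric against itself is 2, which absorbs the factor one half. *)
have -> : metric_trace (induced_metric F z) (fun i j => g i j z / r : R^o) =
   (\sum_i (invmx (induced_metric F z) *m induced_metric F z) i i) / r.
  rewrite mulr_suml; apply: eq_bigr => i _; rewrite mxE mulr_suml; apply: eq_bigr => j _.
  by rewrite induced_metricE dotC /GRing.scale /= mulrA.
rewrite mulVmx // big_ord_recl big_ord_recl big_ord0 !mxE !eqxx addr0.
by rewrite !mulr1n; field.
Qed.
End LocalSurface.

(** * Invariance under change of coordinates *)

Section Change.
Context {R : realType} {n : nat} {U W : set 'rV[R]_2}.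
Context {F F' : 'rV[R]_2 -> 'rV[R]_n} {tau : 'rV[R]_2 -> 'rV[R]_2}.
Hypotheses (oU : open U) (oW : open W) (sF : smooth_on U F) (stau : smooth_on W tau).
Hypothesis tauW : forall z, W z -> U (tau z).
Hypothesis F'E : forall z, W z -> F' z = F (tau z).
Let J z : 'M[R]_2 := \matrix_(i, a) pd i tau z 0 a.

Lemma pd_comp (f : 'rV[R]_2 -> 'rV[R]_n) i z : smooth_on U f -> W z ->
  pd i (f \o tau) z = \sum_a J z i a *: pd a f (tau z).
Proof.
move=> sf Wz; have dt := smooth_diff stau Wz; have df := smooth_diff sf (tauW Wz).
rewrite pdE partialE; last exact: differentiable_comp.
rewrite diff_comp //= diff_partial //; apply: eq_bigr => a _.
by rewrite mxE !pdE (partialE i dt).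
Qed.

Lemma pd_change i z : W z -> pd i F' z = \sum_a J z i a *: pd a F (tau z).
Proof. by move=> Wz; rewrite -pd_comp //; exact: (pd_ext i oW Wz F'E). Qed.

Lemma induced_metric_change z : W z ->
  induced_metric F' z = J z *m induced_metric F (tau z) *m (J z)^T.
Proof.
move=> Wz; apply/matrixP => i j; rewrite induced_metricE !pd_change // dot_sumr mxE.
apply: eq_bigr => b _; rewrite dotZr dot_suml !mxE mulr_sumr mulr_suml.
by apply: eq_bigr => a _; rewrite dotZl ?mxE !pdE; ring.
Qed.

Lemma smooth_J i a : smooth_on W (fun w => J w i a).
Proof.
have := (smooth_coordP oW (pd i tau)).1 (smooth_pd i stau) a.
by apply: smooth_ext => // w Ww; rewrite mxE.
Qed.

Lemma pd2_change i j z : W z -> pd i (pd j F') z =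
  \sum_a (pd i (fun w => J w j a) z *: pd a F (tau z)) +
  \sum_a \sum_b (J z i a * J z j b) *: pd a (pd b F) (tau z).
Proof.
move=> Wz.
have E := pd_ext i oW Wz (fun w (Ww : W w) => pd_change j Ww).
rewrite E.
have d a : differentiable (fun w => pd a F (tau w)) z.
  by apply: (@differentiable_comp _ _ _ _ tau (pd a F)); [exact: smooth_diff stau Wz|exact: smooth_diff (smooth_pd a sF) (tauW Wz)].
have dJ a : differentiable (fun w => J w j a) z by exact: smooth_diff (smooth_J j a) Wz.
have dJd a : differentiable (fun w => J w j a *: pd a F (tau w)) z by exact: differentiable_scale.
under [X in pd i X]eq_fun do rewrite (@sum_ord2 _ _ 0 1) //.
rewrite pdD // !pd_scale //.
rewrite [X in _ = _ + X]exchange_big /= [in RHS](@sum_ord2 _ _ 0 1) // [X in _ = _ + X](@sum_ord2 _ _ 0 1) //.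
have C a : pd i (fun w => pd a F (tau w)) z = \sum_b J z i b *: pd b (pd a F) (tau z).
  exact: (pd_comp i (smooth_pd a sF) Wz).
have D a : J z j a *: pd i (fun w => pd a F (tau w)) z =
   \sum_b (J z i b * J z j a) *: pd b (pd a F) (tau z).
  by rewrite C scaler_sumr; apply: eq_bigr => b _; rewrite scalerA mulrC.
by rewrite !D addrACA.
Qed.

Hypothesis gu : forall z, W z -> induced_metric F' z \in unitmx.

(** The tangential projection is itself a metric trace, hence independent of the coordinates. *)
Lemma normal_part_change z v : W z -> normal_part F' z v = normal_part F (tau z) v.
Proof.
move=> Wz; rewrite /normal_part; congr (_ - _); rewrite !tangent_partE.
have gu' := gu Wz; rewrite induced_metric_change // in gu' *.
rewrite -[RHS](metric_trace_change _ gu'); apply: metric_trace_ext => i j.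
rewrite !pd_change // dot_sumr scaler_suml; apply: eq_bigr => a _.
by rewrite scaler_sumr; apply: eq_bigr => b _; rewrite dotZr !scalerA; congr (_ *: _); ring.
Qed.

Hypothesis gu0 : forall z, U z -> induced_metric F z \in unitmx.

(** In [pd2_change] the derivatives of the Jacobian multiply tangent vectors, which the normal
    projection kills; h is therefore a tensor. *)
Lemma second_form_change i j z : W z -> second_form F' z i j =
  \sum_a \sum_b (J z i a * J z j b) *: second_form F (tau z) a b.
Proof.
move=> Wz; rewrite /second_form -!pdE normal_part_change // pd2_change //.
rewrite normal_partD !normal_part_sum big1 ?add0r => [|a _]; last first.
  by rewrite normal_partZ normal_part_tangent ?scaler0 //; exact: gu0 (tauW Wz).
apply: eq_bigr => a _; rewrite normal_part_sum; apply: eq_bigr => b _.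
by rewrite normal_partZ -!pdE.
Qed.

Lemma mean_curvature_change z : W z ->
  mean_curvature_local F' z = mean_curvature_local F (tau z).
Proof.
move=> Wz; rewrite /mean_curvature_local; apply: (congr1 (fun v => 2^-1 *: v)).
move: (induced_metric F' z) (induced_metric_change Wz) (gu Wz) => _ -> gu'.
rewrite -[RHS](metric_trace_change _ gu'); apply: metric_trace_ext => i j.
exact: second_form_change.
Qed.
End Change.

(** * Charts *)

(** The level set through [p] is open and closed. *)
Lemma connected_locally_cst (T : topologicalType) (Y : Type) (f : T -> Y) :
  connected [set: T] -> (forall p, \forall p' \near p, f p' = f p) ->
  forall p p', f p = f p'.
Proof.
move=> cT lc p p'; pose B := [set p'' | f p'' = f p].
suff -> : [set: T] p' -> f p = f p' by [].
have oB : open B.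
  by rewrite openE => w Bw; rewrite /interior; apply: filterS (lc w) => w' E; rewrite /B /= E.
have cB : closed B.
  rewrite -openC openE => w nBw; rewrite /interior.
  by apply: filterS (lc w) => w' E; rewrite /B /= E.
have BT : B = [set: T].
  apply: cT; first by exists p.
  - by exists B => //; rewrite setTI.
  - by exists B => //; rewrite setTI.
by move=> _; have : B p' by rewrite BT.
Qed.

Section Charts.
Context {R : realType} {M : surface R}.
Implicit Types (phi psi : chart R M) (p : M).

Lemma chart_at_atlas p : atlas (chart_at p).
Proof. exact: (s2valP (cid2 (atlas_cover p))). Qed.

Lemma chart_at_dom p : chart_dom (chart_at p) p.
Proof. exact: (s2valP' (cid2 (atlas_cover p))). Qed.

Lemma chart_overlap_open phi psi : open (phi @` (chart_dom phi `&` chart_dom psi)).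
Proof.
have E : phi @` (chart_dom phi `&` chart_dom psi) =
    chart_cod phi `&` (chart_inv phi @^-1` chart_dom psi).
  apply/seteqP; split=> [_ [p [dp dp'] <-]|z [cz dz]] /=.
    by split; [exact: chart_map_cod|rewrite /= chart_mapK].
  exists (chart_inv phi z); last exact: chart_invK.
  by split=> //; exact: chart_inv_dom.
rewrite E openE => z [cz dz]; rewrite /interior.
have oc := @chart_cod_open _ _ phi.
apply: filterI; first exact: (open_nbhs_nbhs (conj oc cz)).
have := @chart_inv_continuous _ _ phi; rewrite continuous_open_subspace // => C.
have zi : z \in chart_cod phi by rewrite inE.
exact: (C z zi _ (open_nbhs_nbhs (conj (chart_dom_open psi) dz))).
Qed.

Lemma near_chart phi p (A : set 'rV[R]_2) : chart_dom phi p -> nbhs (phi p) A ->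
  \forall p' \near p, chart_dom phi p' /\ A (phi p').
Proof.
move=> dp nA; have od := chart_dom_open phi.
have := @chart_map_continuous _ _ phi; rewrite continuous_open_subspace // => C.
have pi : p \in chart_dom phi by rewrite inE.
apply: filterI; first exact: (open_nbhs_nbhs (conj od dp)).
exact: (C p pi _ nA).
Qed.

Context {n : nat} {x : M -> 'rV[R]_n}.
Hypothesis imm : immersion x.
Local Notation H := (mean_curvature_vector x).

Lemma chart_smooth phi : atlas phi -> smooth_on (chart_cod phi) (in_chart phi x).
Proof. by case: imm => sx _; exact: sx. Qed.

Lemma chart_free phi : atlas phi ->
  forall z, chart_cod phi z -> row_free ('J (in_chart phi x) z).
Proof. by case: imm => _; apply. Qed.

Lemma in_chartK (T : Type) (f : M -> T) phi p : chart_dom phi p -> in_chart phi f (phi p) = f p.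
Proof. by move=> dp; rewrite /in_chart /= chart_mapK. Qed.

(** Replaces the chart chosen for [p] by any chart around [p], via the transition map between them.
    This is what makes the vector a smooth map in a fixed chart. *)
Lemma mean_curvature_vector_chart phi p : atlas phi -> chart_dom phi p ->
  H p = mean_curvature_local (in_chart phi x) (phi p).
Proof.
move=> aphi dp; set psi := chart_at p.
have apsi : atlas psi := chart_at_atlas p.
have dpsi : chart_dom psi p := chart_at_dom p.
pose W := phi @` (chart_dom phi `&` chart_dom psi).
have Wp : W (phi p) by exists p.
have Wc : W `<=` chart_cod phi by move=> _ [p' [d1 d2] <-]; exact: chart_map_cod.
have tauW z : W z -> chart_cod psi ((psi \o chart_inv phi) z).
  by move=> [p' [d1 d2] <-]; rewrite /= chart_mapK //; exact: chart_map_cod.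
have FE z : W z -> in_chart phi x z = in_chart psi x ((psi \o chart_inv phi) z).
  by move=> [p' [d1 d2] <-]; rewrite /in_chart /= (chart_mapK d1) chart_mapK.
have gu ph z : atlas ph -> chart_cod ph z -> induced_metric (in_chart ph x) z \in unitmx.
  move=> aph; apply: induced_metric_unit; [exact: chart_smooth|exact: chart_free].
have := @mean_curvature_change _ _ _ W _ _ _ (@chart_overlap_open phi psi)
  (chart_smooth apsi) (atlas_compatible aphi apsi) tauW FE
  (fun z Wz => gu _ _ aphi (Wc _ Wz)) (fun z Uz => gu _ _ apsi Uz) _ Wp.
by move=> ->; rewrite /= chart_mapK.
Qed.

Lemma laplace_mapE p : laplace_map x p = - (2 *: H p).
Proof.
have ap := chart_at_atlas p.
have cp := chart_map_cod (chart_at_dom p).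
exact: (laplacianE (@chart_cod_open _ _ (chart_at p)) (chart_smooth ap) cp).
Qed.

Lemma in_chart_mean_curvature phi z : atlas phi -> chart_cod phi z ->
  in_chart phi H z = mean_curvature_local (in_chart phi x) z.
Proof.
move=> aphi cz; rewrite /in_chart /=.
by rewrite (mean_curvature_vector_chart aphi) ?chart_invK //; exact: chart_inv_dom.
Qed.

Lemma smooth_in_chart_mean_curvature phi : atlas phi -> smooth_on (chart_cod phi) (in_chart phi H).
Proof.
move=> aphi; apply: (smooth_ext (@chart_cod_open _ _ phi) _ (smooth_mean_curvature (@chart_cod_open _ _ phi) (chart_smooth aphi) (chart_free aphi))).
by move=> z cz; rewrite in_chart_mean_curvature.
Qed.

Lemma sphere_mean_curvature_vectorE q (r : R) p : 0 < r ->
  (forall p, hypersphere q r (x p)) ->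
  sphere_mean_curvature_vector q x p = H p + r ^- 2 *: (x p - q).
Proof.
move=> r0 sph; have ap := chart_at_atlas p; have dp := chart_at_dom p.
rewrite -[in RHS](in_chartK x dp).
have cp := chart_map_cod dp.
apply: (sphere_mean_curvature_localE (@chart_cod_open _ _ (chart_at p)) (chart_smooth ap) (chart_free ap) _ _ cp).
  by rewrite expf_neq0 // gt_eqF.
move=> w cw; have := sph (chart_inv (chart_at p) w).
  by rewrite /hypersphere /= /enorm => <-; rewrite sqr_sqrtr // dot_ge0.
Qed.
End Charts.

Lemma diff_scale_sub (R : realType) (m n : nat) (f : 'rV[R]_m -> 'rV[R]_n) (k : R) q z u :
  differentiable f z -> 'd (fun w => k *: (f w - q)) z u = k *: 'd f z u.
Proof.
move=> df; have dq : differentiable (fun w => f w - q) z by exact: differentiableB.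
have dk : differentiable (fun w => k *: (f w - q)) z by exact: differentiableZ.
have E i : partial i (fun w => k *: (f w - q)) z = k *: partial i f z.
  by rewrite -!pdE pdZ // pdD // pd_cst addr0.
apply: etrans (diff_partial u dk) (etrans _ (congr1 (fun v => k *: v) (esym (diff_partial u df)))).
rewrite scaler_sumr; apply: eq_bigr => i _.
by rewrite E !scalerA mulrC.
Qed.

(** * The two implications *)

Section Main.
Context {R : realType} {M : surface R} {x : M -> 'rV[R]_4}.
Hypothesis imm : immersion x.
Local Notation H := (mean_curvature_vector x).

Lemma minimal_homothetic : minimal_in_hypersphere x -> homothetic_laplace_transformation x.
Proof.
move=> [q [r [r0 sph min]]].
have HE p : H p = - (r ^- 2 *: (x p - q)).
  by apply/eqP; rewrite -addr_eq0 -(sphere_mean_curvature_vectorE imm _ r0 sph) min.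
have LE : laplace_map x = (fun p => (2 * r ^- 2) *: (x p - q)).
  by apply/funext => p; rewrite (laplace_mapE imm) HE scalerN opprK scalerA.
exists (2 * r ^- 2); first by rewrite mulr_gt0 // invr_gt0 exprn_gt0.
move=> phi aphi p dp u v.
have dx : differentiable (in_chart phi x) (phi p).
  by apply: smooth_diff (chart_smooth imm aphi) _; exact: chart_map_cod.
have -> : in_chart phi (laplace_map x) = (fun z => (2 * r ^- 2) *: (in_chart phi x z - q)).
  by apply/funext => z; rewrite /in_chart /= LE.
apply: etrans (congr2 (@dot R 4) (diff_scale_sub _ q u dx) (diff_scale_sub _ q v dx)) _.
by rewrite dotZl dotZr mulrA expr2.
Qed.

Hypothesis conn : connected [set: M].

Lemma homothetic_minimal : constant_mean_curvature x ->
  homothetic_laplace_transformation x -> minimal_in_hypersphere x.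
Proof.
move=> [al alE] [c c0 hom].
have [[p0 _]|M0] := pselect ([set: M] !=set0); last first.
  (* On an empty carrier any hypersphere does. *)
  exists 0, 1; split=> // p; by exfalso; apply: M0; exists p.
(* The Laplace map is - 2 H, so the ratio [c] for it becomes [c / 2] for H. *)
pose k := c / 2; have k0 : 0 < k by rewrite divr_gt0.
pose A := al ^+ 2.
have HH p : dot (H p) (H p) = A.
  by rewrite /A -(alE p) /enorm sqr_sqrtr // dot_ge0.
pose N (phi : chart R M) := in_chart phi H; pose F (phi : chart R M) := in_chart phi x.
have dNdN phi : atlas phi -> forall i j z, chart_cod phi z ->
    dot (pd i (N phi) z) (pd j (N phi) z) = k ^+ 2 * dot (pd i (F phi) z) (pd j (F phi) z).
  move=> aphi i j z cz.
  have dF := smooth_diff (chart_smooth imm aphi) cz.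
  have dN := smooth_diff (smooth_in_chart_mean_curvature imm aphi) cz.
  have LE : in_chart phi (laplace_map x) = (fun w => (- 2) *: (N phi w - 0)).
    by apply/funext => w; rewrite /N /in_chart /= (laplace_mapE imm) subr0 scaleNr.
  have dL l : 'd (in_chart phi (laplace_map x)) z (delta_mx 0 l) = (- 2) *: pd l (N phi) z.
    by rewrite LE; apply: etrans (diff_scale_sub _ _ _ dN) _; rewrite pdE (partialE l dN).
  have dFl l : 'd (F phi) z (delta_mx 0 l) = pd l (F phi) z.
    by rewrite pdE; exact: esym (partialE l dF).
  have := hom phi aphi (chart_inv phi z) (chart_inv_dom cz) (delta_mx 0 i) (delta_mx 0 j).
  rewrite chart_invK // => E.
  have := etrans (esym (congr2 (@dot R 4) (dL i) (dL j)))
    (etrans E (congr1 (fun e => c ^+ 2 * e) (congr2 (@dot R 4) (dFl i) (dFl j)))).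
  rewrite dotZl dotZr /k expr_div_n => {}E.
  by rewrite mulrAC -E; field.
pose psi := chart_at p0.
have apsi : atlas psi := chart_at_atlas p0.
have cp0 : chart_cod psi (psi p0) by apply: chart_map_cod; exact: chart_at_dom.
have g0 phi i z : atlas phi -> chart_cod phi z -> 0 < dot (pd i (F phi) z) (pd i (F phi) z).
  by move=> aphi cz; apply: metric_gt0 cz; [exact: chart_smooth|exact: chart_free].
(* If [A] were zero, H would vanish identically and homothety would give a tangent vector at
   [psi p0] length zero. *)
have A0 : 0 < A.
  rewrite lt_neqAle sqr_ge0 andbT; apply/eqP => A00.
  have N0 z : N psi z = 0 by apply/eqP; rewrite -dot_eq0 /N /in_chart /= HH -A00.
  have := dNdN _ apsi 0 0 _ cp0.
  have -> : N psi = (fun=> 0) by apply/funext.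
  rewrite pd_cst dot0l => /esym/eqP; rewrite mulf_eq0 expf_eq0 /= !gt_eqF //.
  exact: g0.
have dy0 phi : atlas phi -> forall i z, chart_cod phi z -> pd i (fun w => N phi w + k *: F phi w) z = 0.
  move=> aphi i z cz.
  have oc := @chart_cod_open _ _ phi; have sF := chart_smooth imm aphi; have fF := chart_free imm aphi.
  have NE w : chart_cod phi w -> N phi w = mean_curvature_local (F phi) w.
    exact: in_chart_mean_curvature.
  apply: (@dy_eq0 R (chart_cod phi) (F phi) (N phi) k A oc sF) => //.
  - exact: smooth_in_chart_mean_curvature.
  - by move=> j w cw; rewrite NE //; exact: (mean_curvature_perp sF fF j cw).
  - by move=> w _; rewrite /N /in_chart /= HH.
  - exact: dNdN.
  - by move=> j w; exact: g0.
  - by move=> j l w jl cw; apply: (metric_det_gt0 sF fF jl cw).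
  - by move=> j l w jl cw; rewrite NE //; apply: mean_curvature_trace oc sF fF _ _ _ jl cw.
pose Y p := H p + k *: x p.
have Ycst p p' : Y p = Y p'.
  apply: connected_locally_cst conn _ p p' => {}p.
  pose phi := chart_at p.
  have aphi : atlas phi := chart_at_atlas p.
  have dp : chart_dom phi p := chart_at_dom p.
  have oc := @chart_cod_open _ _ phi.
  have cp : chart_cod phi (phi p) by exact: chart_map_cod.
  (* A ball inside the chart codomain is convex, so vanishing derivatives make [y] constant on
     it. *)
  have /nbhs_ballP[e /= e0 He] := open_nbhs_nbhs (conj oc cp).
  have nb : nbhs (phi p) (ball (phi p) e) by exact: nbhsx_ballx.
  apply: filterS (near_chart dp nb) => p' [dp' bp'].
  pose y w := N phi w + k *: F phi w.
  have yY p'' : chart_dom phi p'' -> y (phi p'') = Y p''.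
    by move=> d; rewrite /y /N /F !in_chartK.
  rewrite -!yY //.
  have sy : smooth_on (chart_cod phi) y.
    apply: smoothD => //; first exact: smooth_in_chart_mean_curvature.
    by apply: smooth_scale => //; [exact: smooth_cst|exact: chart_smooth].
  apply/rowP => j.
  have dy w : ball (phi p) e w -> differentiable y w by move=> /He cw; exact: smooth_diff sy cw.
  have dyj w : ball (phi p) e w -> differentiable (fun w => y w 0 j) w.
    by move=> bw; exact: ((differentiable_coordP _ _).1 (dy w bw) j).
  apply: (@ball_cst R _ (fun w => y w 0 j) (phi p) e) => // w bw v.
  rewrite diff_partial; last exact: dyj.
  rewrite big1 // => i _; rewrite -partial_coord; last exact: dy.
  by rewrite -pdE dy0 ?mxE ?scaler0 //; exact: He.
pose q := k^-1 *: Y p0.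
have kn : k != 0 by rewrite gt_eqF.
have HE p : H p = - (k *: (x p - q)).
  rewrite /q scalerBr scalerA mulfV // scale1r opprB (Ycst p0 p) /Y.
  by rewrite addrK.
have sphq p : dot (x p - q) (x p - q) = A / k ^+ 2.
  by rewrite -(HH p) HE dotNl dotNr opprK dotZl dotZr; field.
pose r := Num.sqrt (A / k ^+ 2).
have Ak : 0 < A / k ^+ 2 by rewrite divr_gt0 // exprn_gt0.
have r0 : 0 < r by rewrite sqrtr_gt0.
have rr : r ^+ 2 = A / k ^+ 2 by rewrite sqr_sqrtr // ltW.
have sph p : hypersphere q r (x p) by rewrite /hypersphere /= /enorm sphq.
exists q, r; split=> // p.
rewrite (sphere_mean_curvature_vectorE imm _ r0 sph) HE rr.
(* The left side is [(k ^+ 2 / A - k) *: (x p - q)], which vanishes once [A = k]. *)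
suff -> : A = k by rewrite -scaleNr -scalerDl; apply/eqP; rewrite scaler_eq0; apply/orP; left; apply/eqP; field.
(* trace of the Hessian of x against the radial vector, computed in two ways *)
pose phi := chart_at p.
have aphi : atlas phi := chart_at_atlas p.
have dp : chart_dom phi p := chart_at_dom p.
have oc := @chart_cod_open _ _ phi; have sF := chart_smooth imm aphi; have fF := chart_free imm aphi.
have cp : chart_cod phi (phi p) by exact: chart_map_cod.
have sphF w : chart_cod phi w -> dot (F phi w - q) (F phi w - q) = A / k ^+ 2.
  by move=> _; rewrite /F /in_chart /= sphq.
have perp l : dot (pd l (F phi) (phi p)) (F phi (phi p) - q) = 0.
  by rewrite dotC (sphere_perp oc sF l sphF cp).
have := mean_curvature_trace oc sF fF (isT : (0 : 'I_2) != 1) cp perp.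
rewrite !(sphere_hess oc sF _ _ sphF cp) -in_chart_mean_curvature // !in_chartK //.
have Fp : F phi (phi p) = x p by exact: in_chartK.
rewrite Fp HE dotNl dotZl sphq.
have := metric_det_gt0 sF fF (isT : (0 : 'I_2) != 1) cp.
set D := _ - _ ^+ 2 => D0 E.
have Dn : D != 0 by rewrite gt_eqF.
have E2 : - (2 * D) = 2 * D * - (k * (A / k ^+ 2)) by rewrite -E /D; ring.
have D2 : 2 * D != 0 by rewrite mulf_neq0.
apply: (mulfI D2); transitivity (- (2 * D * - (k * (A / k ^+ 2))) * k); first by field.
by rewrite -E2; ring.
Qed.
End Main.

Theorem theorem3p2 (R : realType) (M : surface R) (x : M -> 'rV[R]_4) :
  connected [set: M] ->
  immersion x ->
  constant_mean_curvature x ->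
  homothetic_laplace_transformation x <-> minimal_in_hypersphere x.
Proof.
move=> conn imm cmc; split; first exact: homothetic_minimal.
exact: minimal_homothetic.
Qed.
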